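(* Let $m,n\in\mathbb{N}$ be such that $n\leq m$ and let $A$ be an invertible bounded operator on a complex Hilbert space such that $(A^* )^sA^s=(A^*A)^s$ for all $s\in\{m,\,n+m\}$ and $(A^* )^nA^n\leq(A^*A)^n$. Then $$|A^{n}|^{\frac{2}{n}}\leq|A^{m+n}|^{\frac{2}{m+n}}\leq|A^{2m+n}|^{\frac{2}{2m+n}}\leq\dots\leq|A^{rm+n}|^{\frac{2}{rm+n}}$$ for every $r\in\mathbb{N}$.
   Context: $\mathbb{N}$ denotes the set of positive integers. For a bounded operator $T$, $|T|:=(T^*T)^{1/2}$. Real powers of positive operators are taken via the functional calculus, and $\leq$ is the usual order on bounded selfadjoint operators. Invertible means having a bounded everywhere defined inverse. *)

(* Defs.v *)
From HB Require Import structures.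
From mathcomp Require Import all_boot all_order all_algebra.
From mathcomp Require Export sesquilinear.
From mathcomp Require Export complex.
From mathcomp Require Export all_classical all_reals all_analysis.

Set Implicit Arguments.
Unset Strict Implicit.
Unset Printing Implicit Defensive.

Import Order.TTheory GRing.Theory Num.Theory.
Import numFieldNormedType.Exports.

Local Open Scope classical_set_scope.
Local Open Scope complex_scope.
Local Open Scope ring_scope.

(* The library form [{dot H for Num.conj}] is positive definite, linear in its
   first argument and conjugate-linear in the second one. *)
HB.mixin Record isHilbert (R : realType) H of CompleteNormedModule R[i] H := {
  inner : {dot H for @Num.conj R[i]};
  inner_norm : forall x : H, inner x x = `|x| ^+ 2
}.

#[short(type="hilbertType")]
HB.structure Definition Hilbert (R : realType) :=
  {H of isHilbert R H & CompleteNormedModule R[i] H}.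

Section Operators.
Variables (R : realType) (H : hilbertType R).
Implicit Types (S T : H -> H).

Definition bounded_operator T :=
  linear T /\ exists M : R, forall x, `|T x| <= M%:C * `|x|.

Definition op_invertible T :=
  exists S, [/\ bounded_operator S, cancel T S & cancel S T].

(* The adjoint is unique when it exists, and it exists for bounded [T]; the
   value is unspecified otherwise. *)
Definition adjoint T : H -> H :=
  get [set S | forall x y, inner (T x) y = inner x (S y)].

(* [<=] on [R[i]] forces equal imaginary parts, so this only relates operators
   whose difference is selfadjoint. *)
Definition op_le S T := forall x, inner (S x) x <= inner (T x) x.

Definition spectrum T : set R[i] :=
  [set z | ~ op_invertible (fun x => T x - z *: x)].

Definition op_horner (p : {poly R}) T : H -> H :=
  fun x => \sum_(i < size p) (p`_i)%:C *: iter i T x.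

(* [S = f(T)] for a selfadjoint [T] and [f] continuous on its (real) spectrum:
   [S] is the operator-norm limit of [p_k(T)] for real polynomials [p_k]
   converging to [f] uniformly on the spectrum. *)
Definition is_functional_calculus (f : R -> R) T S :=
  exists p : nat -> {poly R},
    (forall e : R, 0 < e -> \forall k \near \oo,
       forall t : R, spectrum T t%:C -> `|(p k).[t] - f t| <= e) /\
    (forall e : R, 0 < e -> \forall k \near \oo,
       forall x, `|op_horner (p k) T x - S x| <= e%:C * `|x|).

(* Unspecified when [f(T)] does not exist. *)
Definition functional_calculus (f : R -> R) T : H -> H :=
  get [set S | is_functional_calculus f T S].

Definition op_powR T (a : R) : H -> H :=
  functional_calculus (fun t => t `^ a) T.

Definition op_abs T : H -> H := op_powR (adjoint T \o T) 2^-1.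

End Operators.

(* Main.v *)
(* Put [T = A^* A], [G_k = (A^* )^k A^k = |A^k|^2] and [A^m = U T^(m/2)], [U]
   unitary, so that [G_(k+m) = T^(m/2) (U^* G_k U) T^(m/2)]; the hypotheses
   give [U^* G_n U = T^n] and [G_n <= T^n]. With [p = j m + n] and [q = p + m],
   induction on [j] shows [G_p <= G_q^(p/q)], from which the theorem follows by
   the Loewner-Heinz inequality. For the induction step let
   [E = (U^* G_q U)^(1/q)]; then [U^* G_p U <= E^p] and [T^n <= E^n], so that
   [G_q <= T^(m/2) E^p T^(m/2)] and [G_(q+m) = T^(m/2) E^q T^(m/2)], and it
   remains to prove
     [T^(m/2) E^p T^(m/2) <= (T^(m/2) E^q T^(m/2))^(q/(q+m))].
   By [(Z^* Z)^(c+1) = Z^* (Z Z^* )^c Z] this follows from the Furuta type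
   inequality [(E^(q/2) T^m E^(q/2))^(q/(m+q)) <= E^q], proved by enlarging the
   outer exponent from [n] to [q] in unit steps.

   The functional calculus of a selfadjoint [X] rests on
   [|p(X)| <= sup |p|] over the approximate point spectrum: [S^2 - |S|^2] is not
   bounded below for [S = p(X)], hence neither is one of the real factors
   [X - a] of [p(X)^2 - |S|^2]. *)
Require Import Defs.
From HB Require Import structures.
From mathcomp Require Import all_boot all_order all_algebra.
From mathcomp Require Import all_classical all_reals all_analysis.
From mathcomp Require Import ring lra.

Set Implicit Arguments.
Unset Strict Implicit.
Unset Printing Implicit Defensive.

Import Order.TTheory GRing.Theory Num.Theory.
Import numFieldNormedType.Exports.

Local Open Scope classical_set_scope.
Local Open Scope complex_scope.
Local Open Scope ring_scope.

Lemma natSinv_small (R : realType) (e : R) : 0 < e ->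
  exists N, forall i, (N <= i)%N -> (i.+1%:R^-1 : R) < e.
Proof.
by move=> e0; have [N _ hN] := near_infty_natSinv_lt (PosNum e0); exists N.
Qed.

(** * The real part of the inner product and the Riesz representation *)

Section RealInner.
Variables (R : realType) (H : hilbertType R).
Implicit Types (x y z : H) (a b : R).

Definition rip x y : R := complex.Re (inner x y).
Definition nm x : R := complex.Re `|x|.

Lemma cReD (u v : R[i]) : complex.Re (u + v) = complex.Re u + complex.Re v.
Proof. by case: u v => [? ?] []. Qed.

Lemma cReN (u : R[i]) : complex.Re (- u) = - complex.Re u.
Proof. by case: u. Qed.

Lemma cReM (a : R) (v : R[i]) : complex.Re (a%:C * v) = a * complex.Re v.
Proof. by case: v => c d /=; rewrite mul0r subr0. Qed.

Lemma nmE x : `|x| = (nm x)%:C.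
Proof. by rewrite /nm RRe_real // ger0_real. Qed.

Lemma nm_ge0 x : 0 <= nm x.
Proof. by rewrite -ler0c -nmE. Qed.

Lemma nm0 : nm 0 = 0.
Proof. by rewrite /nm normr0. Qed.

Lemma nm_eq0 x : (nm x == 0) = (x == 0).
Proof. by rewrite -(normr_eq0 x) nmE eq_complex /= eqxx andbT. Qed.

Lemma nmN x : nm (- x) = nm x.
Proof. by rewrite /nm normrN. Qed.

Lemma nmB x y : nm (x - y) = nm (y - x).
Proof. by rewrite /nm distrC. Qed.

Lemma nmD x y : nm (x + y) <= nm x + nm y.
Proof. by rewrite -lecR rmorphD /= -!nmE ler_normD. Qed.

Lemma nmZ a x : nm (a%:C *: x) = `|a| * nm x.
Proof.
by rewrite /nm normrZ normc_def /= expr0n /= addr0 sqrtr_sqr cReM.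
Qed.

Lemma inner_hermC x y : inner x y = Num.conj (inner y x).
Proof. by rewrite hermC expr0 mul1r. Qed.

Lemma ripC x y : rip x y = rip y x.
Proof. by rewrite /rip inner_hermC; case: (inner y x). Qed.

Lemma ripDl x y z : rip (x + y) z = rip x z + rip y z.
Proof. by rewrite /rip linearDl cReD. Qed.

Lemma ripNl x y : rip (- x) y = - rip x y.
Proof. by rewrite /rip linearNl cReN. Qed.

Lemma ripBl x y z : rip (x - y) z = rip x z - rip y z.
Proof. by rewrite ripDl ripNl. Qed.

Lemma ripZl a x y : rip (a%:C *: x) y = a * rip x y.
Proof. by rewrite /rip linearZl_LR /= cReM. Qed.

Lemma ripDr x y z : rip x (y + z) = rip x y + rip x z.
Proof. by rewrite ripC ripDl !(ripC x). Qed.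

Lemma ripNr x y : rip x (- y) = - rip x y.
Proof. by rewrite ripC ripNl ripC. Qed.

Lemma ripBr x y z : rip x (y - z) = rip x y - rip x z.
Proof. by rewrite ripDr ripNr. Qed.

Lemma ripZr a x y : rip x (a%:C *: y) = a * rip x y.
Proof. by rewrite ripC ripZl ripC. Qed.

Lemma rip0l x : rip 0 x = 0.
Proof. by rewrite -(subrr 0) ripBl subrr. Qed.

Lemma ripxx x : rip x x = nm x ^+ 2.
Proof. by rewrite /rip inner_norm nmE -rmorphXn. Qed.

Lemma nm_sqrD x y : nm (x + y) ^+ 2 = nm x ^+ 2 + 2 * rip x y + nm y ^+ 2.
Proof. by rewrite -!ripxx !ripDl !ripDr (ripC y x); ring. Qed.

Lemma nm_sqrB x y : nm (x - y) ^+ 2 = nm x ^+ 2 - 2 * rip x y + nm y ^+ 2.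
Proof. by rewrite nm_sqrD nmN ripNr; ring. Qed.

(** Expanding the squared norm of [nm y x - nm x y] gives the inequality multiplied by
    [nm x * nm y]; the case where this factor vanishes is separate. *)
Lemma rip_le x y : rip x y <= nm x * nm y.
Proof.
have H2 : 0 <= (nm x * nm y) * (nm x * nm y - rip x y).
  have := sqr_ge0 (nm ((nm y)%:C *: x - (nm x)%:C *: y)).
  rewrite nm_sqrB !nmZ ripZl ripZr !ger0_norm ?nm_ge0 // => h.
  nra.
have := mulr_ge0 (nm_ge0 x) (nm_ge0 y).
rewrite le_eqVlt => /orP[/eqP xy0|xy_gt0]; last first.
  by rewrite -subr_ge0 -(pmulr_rge0 _ xy_gt0).
rewrite -xy0; move/esym/eqP: xy0; rewrite mulf_eq0 !nm_eq0.
by move=> /orP[]/eqP->; rewrite ?rip0l // ripC rip0l.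
Qed.

Lemma rip_ext x y : (forall z, rip z x = rip z y) -> x = y.
Proof.
move=> h; apply/eqP; rewrite -subr_eq0 -nm_eq0; apply/eqP.
by apply/eqP; rewrite -sqrf_eq0 -ripxx ripBr h subrr.
Qed.

(** Replacing [x] by [-i x] turns the imaginary part of an inner product into a real part, so real
    identities valid for all [x] lift to the complex form. *)
Lemma rip_inner_ext (L M : H -> H) (y z : H) : scalable L -> scalable M ->
  (forall x, rip (L x) y = rip (M x) z) ->
  forall x, inner (L x) y = inner (M x) z.
Proof.
move=> Ls Ms h x; have hR := h x; have hI := h (-'i *: x).
have E (v w : H) : rip (- 'i *: v) w = complex.Im (inner v w).
  rewrite /rip linearZl_LR /=; case: (inner v w) => c d /=; by simpc.
by rewrite Ls Ms !E in hI; apply/eqP;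
  rewrite eq_complex hI -[complex.Re _]/(rip _ _) hR !eqxx.
Qed.

Lemma nm_cauchy_cvg (u : nat -> H) :
  (forall e : R, 0 < e -> exists N, forall i j, (N <= i)%N -> (N <= j)%N ->
     nm (u i - u j) <= e) ->
  exists l, forall e : R, 0 < e -> exists N, forall i, (N <= i)%N ->
     nm (u i - l) <= e.
Proof.
move=> uC.
have cu : cauchy (u @ \oo).
  apply/cauchy_ballP => e e0.
  have e0' : 0 < complex.Re e by move: e0; rewrite ltcE /= => /andP[].
  have e1 : e = (complex.Re e)%:C by rewrite RRe_real // ger0_real // ltW.
  have [|N hN] := uC (complex.Re e / 2); first by lra.
  exists ([set u i | i in [set i | (N <= i)%N]],
          [set u i | i in [set i | (N <= i)%N]]).
    by split; exists N => // i /= Ni; exists i.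
  move=> [_ _] /= [[i Ni <-] [j Nj <-]].
  rewrite -ball_normE /= nmE e1 ltcR.
  by rewrite (le_lt_trans (hN _ _ Ni Nj)) //; lra.
have ul : u @ \oo --> lim (u @ \oo) by exact: cauchy_cvg.
exists (lim (u @ \oo)) => e e0.
have e0' : 0 < e%:C by rewrite ltcR.
have /cvgrPdist_le /(_ e%:C e0') := ul.
move=> [N _ hN]; exists N => i Ni.
by have := hN i Ni; rewrite /= nmE lecR nmB.
Qed.

(* The representing vector minimizes [nm x ^+ 2 - 2 phi x]; minimizing
   sequences are Cauchy by the parallelogram law. *)
Lemma riesz (phi : H -> R) (K : R) :
  (forall x y, phi (x + y) = phi x + phi y) ->
  (forall a x, phi (a%:C *: x) = a * phi x) ->
  0 <= K -> (forall x, phi x <= K * nm x) ->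
  exists z, forall x, phi x = rip x z.
Proof.
move=> phiD phiZ K0 phiK.
pose J x := nm x ^+ 2 - 2 * phi x.
have Jlb x : - K ^+ 2 <= J x.
  have := sqr_ge0 (nm x - K); have := phiK x; rewrite /J; nra.
pose A := [set J x | x in setT].
have infA : has_inf A.
  by split; [exists (J 0); exists 0 | exists (- K ^+ 2) => _ [x _ <-]].
pose d := inf A.
have dJ x : d <= J x by apply: ge_inf; [case: infA | exists x].
have /choice [u uP] : forall n : nat, exists x, J x < d + n.+1%:R^-1.
  move=> n; have [||_ [x _ <-] h] := @inf_adherent _ A n.+1%:R^-1 => //.
  by exists x.
have J4 x y : nm (x - y) ^+ 2 = 2 * (J x + J y - 2 * J (2^-1%:C *: (x + y))).
  rewrite /J nmZ phiZ phiD nm_sqrB exprMn nm_sqrD ger0_norm; first lra.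
  by rewrite invr_ge0.
have uC (e : R) : 0 < e -> exists N, forall i j, (N <= i)%N -> (N <= j)%N ->
    nm (u i - u j) <= e.
  move=> e0.
  have [N /(_ N (leqnn N)) hN] :=
    natSinv_small (divr_gt0 (exprn_gt0 2 e0) (ltr0n R 4)).
  exists N => i j Ni Nj.
  rewrite -(@ler_pXn2r _ 2) ?nnegrE ?nm_ge0 ?(ltW e0) // J4.
  have hi k : (N <= k)%N -> k.+1%:R^-1 <= N.+1%:R^-1 :> R.
    by move=> Nk; rewrite lef_pV2 ?posrE ?ltr0n // ler_nat.
  have := dJ (2^-1%:C *: (u i + u j)); have := uP i; have := uP j.
  have := hi _ Ni; have := hi _ Nj; move: hN.
  move: (N.+1%:R^-1) (j.+1%:R^-1) (i.+1%:R^-1) (J _) (J _) (J _) => *; lra.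
have [z uz] := nm_cauchy_cvg uC.
exists z.
have phiN x : phi (- x) = - phi x.
  by rewrite -scaleN1r -(rmorphN1 (real_complex R)) phiZ mulN1r.
have Jz : J z <= d.
  apply/ler_addgt0Pr => e e0.
  (* If [u k] is within [e'] of [z], then [J z] exceeds [J (u k)] by at most [e' * C]; the summand 1
     keeps [C] positive. *)
  pose C := 1 + 2 * nm z + 2 * K.
  have C1 : 1 <= C by have := nm_ge0 z; rewrite /C; lra.
  pose e' := Num.min 1 (e / (2 * C)).
  have C0 : 0 < 2 * C by lra.
  have e'0 : 0 < e' by rewrite lt_min ltr01 divr_gt0.
  have [N hN] := uz _ e'0.
  have [M /(_ M (leqnn M)) hM] := natSinv_small (divr_gt0 e0 (ltr0n R 2)).
  pose k := maxn N M.
  have h1 := hN k (leq_maxl _ _).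
  have h2 : J (u k) < d + e / 2.
    apply: lt_trans (uP k) _; rewrite ltrD2l; apply: le_lt_trans hM.
    by rewrite lef_pV2 ?posrE ?ltr0n // ler_nat ltnS leq_maxr.
  have h3 : J z <= J (u k) + e' * C.
    have -> : J z = J (u k) + 2 * rip z (z - u k) - nm (z - u k) ^+ 2
       + 2 * phi (u k - z).
      by rewrite /J nm_sqrB phiD phiN ripBr ripxx; lra.
    have := rip_le z (z - u k); have := phiK (u k - z); have := nm_ge0 z.
    have := sqr_ge0 (nm (z - u k)); rewrite (nmB z) /C; move: h1; nra.
  apply: le_trans h3 _.
  have : e' * C <= e / 2.
    have : e' <= e / (2 * C) by rewrite ge_min lexx orbT.
    move=> /(ler_wpM2r (ltW C0)); rewrite divfK ?gt_eqF //; lra.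
  by move: h2; lra.
move=> x.
have key t : 0 <= t * (rip x z - phi x) * 2 + t ^+ 2 * nm x ^+ 2.
  have := dJ (z + t%:C *: x).
  rewrite /J nm_sqrD nmZ ripZr phiD phiZ exprMn real_normK ?num_real // => h.
  have := Jz; rewrite /J (ripC x z); move: h; lra.
apply/eqP; rewrite eq_sym -subr_eq0; apply/eqP.
set g := rip x z - phi x in key *.
(* Adding 1 allows division by [w] even at [x = 0]. Inserting [t = - g / w] in [key] leaves a
   negative multiple of [(g / w) ^+ 2], which forces [g = 0]. *)
pose w := nm x ^+ 2 + 1.
have w0 : 0 < w by rewrite /w ltr_wpDl ?sqr_ge0 ?ltr01.
have := key (- g / w).
have -> : - g / w * g * 2 + (- g / w) ^+ 2 * nm x ^+ 2 =
   - (g / w) ^+ 2 * (w + 1).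
  by rewrite /w; field; rewrite gt_eqF.
rewrite mulNr oppr_ge0 (pmulr_lle0 _ (addr_gt0 w0 ltr01)) => hg.
have : (g / w) ^+ 2 == 0 by rewrite eq_le hg sqr_ge0.
by rewrite expf_eq0 /= mulf_eq0 invr_eq0 (gt_eqF w0) orbF => /eqP.
Qed.

End RealInner.

(** * The ring of bounded operators and its adjoint *)

Section BoundedOperators.
Variables (R : realType) (H : hilbertType R).

(** Bundling makes sums, products and powers of operators available through the algebraic hierarchy;
    by proof irrelevance equality is still pointwise. *)
Record bop := Bop { bop_fun :> H -> H; bopP : bounded_operator bop_fun }.

Implicit Types (X Y Z : bop) (x y : H) (a b : R).

HB.instance Definition _ := gen_eqMixin bop.
HB.instance Definition _ := gen_choiceMixin bop.

Lemma bop_ext X Y : (forall x, X x = Y x) -> X = Y.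
Proof.
case: X Y => [f fP] [g gP] /= fg.
have {}fg : f = g by apply/funext.
by case: g / fg gP => gP; rewrite (Prop_irrelevance fP gP).
Qed.

Lemma bounded_operatorP (f : H -> H) : bounded_operator f <->
  linear f /\ exists2 M : R, 0 <= M & forall x, nm (f x) <= M * nm x.
Proof.
split=> [[fl [M fM]]|[fl [M M0 fM]]]; split=> //.
  exists (Num.max 0 M); first by rewrite le_max lexx.
  move=> x; have := fM x; rewrite !nmE -rmorphM /= lecR => h.
  apply: le_trans h _; apply: ler_wpM2r; first exact: nm_ge0.
  by rewrite le_max lexx orbT.
by exists M => x; rewrite !nmE -rmorphM /= lecR.
Qed.

Lemma bop_bound X : exists2 M : R, 0 <= M & forall x, nm (X x) <= M * nm x.
Proof. by have /bounded_operatorP[] := bopP X. Qed.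

Lemma bop_linear X : linear X.
Proof. by have /bounded_operatorP[] := bopP X. Qed.

HB.instance Definition _ X := GRing.isLinear.Build R[i] H H *:%R X (bop_linear
  X).

Lemma bop_add_subproof X Y : bounded_operator (fun x => X x + Y x).
Proof.
apply/bounded_operatorP; split=> [c x y|].
  by rewrite !linearP scalerDr addrACA.
have [M M0 XM] := bop_bound X; have [N N0 YN] := bop_bound Y.
exists (M + N); first exact: addr_ge0.
by move=> x; rewrite mulrDl (le_trans (nmD _ _)) // lerD.
Qed.

Lemma bop_opp_subproof X : bounded_operator (fun x => - X x).
Proof.
apply/bounded_operatorP; split=> [c x y|].
  by rewrite linearP opprD scalerN.
by have [M M0 XM] := bop_bound X; exists M => // x; rewrite nmN.
Qed.

Lemma bop_zero_subproof : bounded_operator (fun _ : H => 0 : H).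
Proof.
apply/bounded_operatorP; split=> [c x y|]; first by rewrite scaler0 addr0.
by exists 0 => // x; rewrite nm0 mul0r.
Qed.

Lemma bop_one_subproof : bounded_operator (@id H).
Proof.
by apply/bounded_operatorP; split=> //; exists 1 => // x; rewrite mul1r.
Qed.

Lemma bop_mul_subproof X Y : bounded_operator (X \o Y).
Proof.
apply/bounded_operatorP; split=> [c x y|]; first by rewrite /= !linearP.
have [M M0 XM] := bop_bound X; have [N N0 YN] := bop_bound Y.
exists (M * N); first exact: mulr_ge0.
by move=> x; rewrite -mulrA (le_trans (XM _)) // ler_wpM2l.
Qed.

Lemma bop_scale_subproof a X : bounded_operator (fun x => a%:C *: X x).
Proof.
apply/bounded_operatorP; split=> [c x y|].
  by rewrite linearP scalerDr !scalerA mulrC.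
have [M M0 XM] := bop_bound X; exists (`|a| * M); first exact: mulr_ge0.
by move=> x; rewrite nmZ -mulrA ler_wpM2l.
Qed.

Definition bop_add X Y := Bop (bop_add_subproof X Y).
Definition bop_opp X := Bop (bop_opp_subproof X).
Definition bop_zero := Bop bop_zero_subproof.
Definition bop_one := Bop bop_one_subproof.
Definition bop_mul X Y := Bop (bop_mul_subproof X Y).
Definition bop_scale a X := Bop (bop_scale_subproof a X).

Fact bop_addA : associative bop_add.
Proof. by move=> X Y Z; apply: bop_ext => x /=; rewrite addrA. Qed.
Fact bop_addC : commutative bop_add.
Proof. by move=> X Y; apply: bop_ext => x /=; rewrite addrC. Qed.
Fact bop_add0 : left_id bop_zero bop_add.
Proof. by move=> X; apply: bop_ext => x /=; rewrite add0r. Qed.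
Fact bop_addN : left_inverse bop_zero bop_opp bop_add.
Proof. by move=> X; apply: bop_ext => x /=; rewrite addNr. Qed.

HB.instance Definition _ :=
  GRing.isZmodule.Build bop bop_addA bop_addC bop_add0 bop_addN.

Fact bop_mulA : associative bop_mul.
Proof. by move=> X Y Z; apply: bop_ext. Qed.
Fact bop_mul1 : left_id bop_one bop_mul.
Proof. by move=> X; apply: bop_ext. Qed.
Fact bop_mulr1 : right_id bop_one bop_mul.
Proof. by move=> X; apply: bop_ext. Qed.
Fact bop_mulDl : left_distributive bop_mul +%R.
Proof. by move=> X Y Z; apply: bop_ext. Qed.
Fact bop_mulDr : right_distributive bop_mul +%R.
Proof. by move=> X Y Z; apply: bop_ext => x /=; rewrite raddfD. Qed.

(** The ring may be trivial, because [H] may be the zero space. *)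
HB.instance Definition _ := GRing.Zmodule_isPzRing.Build bop
  bop_mulA bop_mul1 bop_mulr1 bop_mulDl bop_mulDr.

Fact bop_scaleA a b X : bop_scale a (bop_scale b X) = bop_scale (a * b) X.
Proof. by apply: bop_ext => x /=; rewrite scalerA -rmorphM. Qed.
Fact bop_scale1 : left_id 1 bop_scale.
Proof. by move=> X; apply: bop_ext => x /=; rewrite scale1r. Qed.
Fact bop_scaleDr : right_distributive bop_scale +%R.
Proof. by move=> a X Y; apply: bop_ext => x /=; rewrite scalerDr. Qed.
Fact bop_scaleDl X a b : bop_scale (a + b) X = bop_scale a X + bop_scale b X.
Proof. by apply: bop_ext => x /=; rewrite rmorphD scalerDl. Qed.

(** Real scalars suffice for real polynomials and, unlike complex ones, commute with the adjoint. *)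
HB.instance Definition _ := GRing.Zmodule_isLmodule.Build R bop
  bop_scaleA bop_scale1 bop_scaleDr bop_scaleDl.

Lemma bopD X Y x : (X + Y) x = X x + Y x. Proof. by []. Qed.
Lemma bopN X x : (- X) x = - X x. Proof. by []. Qed.
Lemma bopB X Y x : (X - Y) x = X x - Y x. Proof. by []. Qed.
Lemma bop0 x : (0 : bop) x = 0. Proof. by []. Qed.
Lemma bop1 x : (1 : bop) x = x. Proof. by []. Qed.
Lemma bopM X Y x : (X * Y) x = X (Y x). Proof. by []. Qed.
Lemma bopZ a X x : (a *: X) x = a%:C *: X x. Proof. by []. Qed.

Lemma bop_iter X k : iter k X = X ^+ k.
Proof.
elim: k => [|k IH]; first by apply/funext.
by apply/funext => x; rewrite iterS exprS IH.
Qed.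

Lemma bopZAl a X Y : (a *: X) * Y = a *: (X * Y).
Proof. exact: bop_ext. Qed.

Lemma bopZAr a X Y : X * (a *: Y) = a *: (X * Y).
Proof. by apply: bop_ext => x; rewrite bopM bopZ linearZ. Qed.

(** The value at [y] is the Riesz vector of [x |-> rip (X x) y]. Complex linearity in [y] needs the
    full inner product, recovered by [rip_inner_ext]. *)
Lemma adj_exists X : exists Y : bop, forall x y, rip (X x) y = rip x (Y y).
Proof.
have [M M0 XM] := bop_bound X.
have /choice [f fP] : forall y, exists z, forall x, rip (X x) y = rip x z.
  move=> y; apply: (@riesz _ _ (fun x => rip (X x) y) (M * nm y)).
  - by move=> u v; rewrite raddfD ripDl.
  - by move=> a u; rewrite linearZ ripZl.
  - by rewrite mulr_ge0 ?nm_ge0.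
  - move=> u; rewrite (le_trans (rip_le _ _)) // mulrAC.
    by rewrite ler_wpM2r ?nm_ge0.
have fI x y : inner (X x) y = inner x (f y).
  apply: (@rip_inner_ext _ _ X id) => //.
  by move=> a u; rewrite linearZ.
have fl : linear f.
  move=> c u v; apply: rip_ext => x; rewrite ripDr -!fP ripDr fP; congr (_ + _).
  by rewrite /rip -fI !linearZr_LR /= fI.
have fb : bounded_operator f.
  apply/bounded_operatorP; split=> //; exists M => // y.
  have := nm_ge0 (f y); rewrite le_eqVlt => /orP[/eqP<-|f0].
    by rewrite mulr_ge0 ?nm_ge0.
  rewrite -(ler_pM2r f0) -expr2 -ripxx -fP (le_trans (rip_le _ _)) //.
  by rewrite mulrAC ler_wpM2r ?nm_ge0.
by exists (Bop fb).
Qed.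

Definition adj X : bop := projT1 (cid (adj_exists X)).

Lemma adjP X x y : rip (X x) y = rip x (adj X y).
Proof. by rewrite /adj; case: cid. Qed.

Lemma adjPl X x y : rip (adj X x) y = rip x (X y).
Proof. by rewrite ripC -adjP ripC. Qed.

Lemma adj_unique X Y : (forall x y, rip (X x) y = rip x (Y y)) -> adj X = Y.
Proof.
by move=> h; apply: bop_ext => y; apply: rip_ext => x; rewrite -adjP.
Qed.

Lemma adjK X : adj (adj X) = X.
Proof. by apply: adj_unique => x y; rewrite adjPl. Qed.

Lemma adjD X Y : adj (X + Y) = adj X + adj Y.
Proof. by apply: adj_unique => x y; rewrite !bopD ripDl ripDr !adjP. Qed.

Lemma adjN X : adj (- X) = - adj X.
Proof. by apply: adj_unique => x y; rewrite !bopN ripNl ripNr !adjP. Qed.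

Lemma adjM X Y : adj (X * Y) = adj Y * adj X.
Proof. by apply: adj_unique => x y; rewrite !bopM !adjP. Qed.

Lemma adjZ a X : adj (a *: X) = a *: adj X.
Proof. by apply: adj_unique => x y; rewrite !bopZ ripZl ripZr adjP. Qed.

Lemma adj1 : adj 1 = 1.
Proof. by apply: adj_unique. Qed.

Lemma adjX X k : adj (X ^+ k) = adj X ^+ k.
Proof.
elim: k => [|k IH]; first by rewrite !expr0 adj1.
by rewrite exprS adjM IH exprSr.
Qed.

Lemma adjointE X : adjoint X = adj X.
Proof.
have adjI x y : inner (X x) y = inner x (adj X y).
  apply: (@rip_inner_ext _ _ X id) => //.
    by move=> a u; rewrite linearZ.
  by move=> u; rewrite adjP.
rewrite /adjoint; case: xgetP => [S _ /= SP|/(_ (adj X)) []] //.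
apply/funext => y; apply: rip_ext => x.
by rewrite /rip -SP adjI.
Qed.

End BoundedOperators.

(** * Operator norm, approximate point spectrum and real polynomials in a selfadjoint operator *)

Section PolynomialCalculus.
Variables (R : realType) (H : hilbertType R).
Local Notation B := (bop H).
Implicit Types (X Y Z : B) (x y : H) (a b c e : R) (p q : {poly R}).

Definition bnd X e := forall x, nm (X x) <= e * nm x.

(** An infimum of bounds also makes sense on the zero space, where there are no unit vectors. *)
Definition nrm X : R := inf [set e | 0 <= e /\ bnd X e].

Lemma nrm_has_inf X : has_inf [set e | 0 <= e /\ bnd X e].
Proof.
split; last by exists 0 => e [].
by have [M M0 XM] := bop_bound X; exists M.
Qed.

Lemma nrm_ge0 X : 0 <= nrm X.
Proof.
by apply: lb_le_inf; [case: (nrm_has_inf X) | move=> e []].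
Qed.

Lemma nrm_le X e : 0 <= e -> bnd X e -> nrm X <= e.
Proof. by move=> e0 Xe; apply: ge_inf => //; case: (nrm_has_inf X). Qed.

Lemma nrmP X : bnd X (nrm X).
Proof.
move=> x; have := nm_ge0 x; rewrite le_eqVlt => /orP[/eqP x0|x0].
  have /eqP := esym x0; rewrite nm_eq0 => /eqP ->.
  by rewrite raddf0 nm0 mulr0.
rewrite -ler_pdivrMr //; apply: lb_le_inf; first by case: (nrm_has_inf X).
by move=> e [_ Xe]; rewrite ler_pdivrMr.
Qed.

Lemma bndW X e e' : e <= e' -> bnd X e -> bnd X e'.
Proof. by move=> ee' Xe x; rewrite (le_trans (Xe x)) // ler_wpM2r ?nm_ge0. Qed.

Lemma bndD X Y e e' : bnd X e -> bnd Y e' -> bnd (X + Y) (e + e').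
Proof.
by move=> Xe Ye' x; rewrite bopD mulrDl (le_trans (nmD _ _)) ?lerD.
Qed.

Lemma bndN X e : bnd X e -> bnd (- X) e.
Proof. by move=> Xe x; rewrite bopN nmN. Qed.

Lemma bndM X Y e e' : 0 <= e -> bnd X e -> bnd Y e' -> bnd (X * Y) (e * e').
Proof.
by move=> e0 Xe Ye' x; rewrite bopM -mulrA (le_trans (Xe _)) // ler_wpM2l.
Qed.

(** Cauchy-Schwarz for [rip (adj X x) (adj X x) = rip x (X (adj X x))]. The sign of [e] is not
    assumed but read off a nonzero vector. *)
Lemma bnd_adj X e : bnd X e -> bnd (adj X) e.
Proof.
move=> Xe x; have := nm_ge0 (adj X x); rewrite le_eqVlt => /orP[/eqP ax0|ax0].
  rewrite -ax0; have := nm_ge0 x; rewrite le_eqVlt => /orP[/eqP <-|x0].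
    by rewrite mulr0.
  rewrite mulr_ge0 ?nm_ge0 // -(pmulr_lge0 _ x0).
  exact: le_trans (nm_ge0 _) (Xe x).
rewrite -(ler_pM2r ax0) -expr2 -ripxx adjPl ripC (le_trans (rip_le _ _)) //.
by rewrite mulrAC ler_wpM2r ?nm_ge0.
Qed.

Lemma bnd_eq0 X : (forall e : R, 0 < e -> bnd X e) -> X = 0.
Proof.
move=> h; apply: bop_ext => x; apply/eqP; rewrite bop0 -nm_eq0.
rewrite eq_le nm_ge0 andbT; apply/ler_addgt0Pr => e e0; rewrite add0r.
have := nm_ge0 x => x0; have x1 : 0 < nm x + 1 by lra.
have := h (e / (nm x + 1)) (divr_gt0 e0 x1) x => h'.
rewrite (le_trans h') // mulrAC ler_pdivrMr //.
by rewrite ler_wpM2l ?(ltW e0) //; lra.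
Qed.

Lemma bnd_unique X Y : (forall e : R, 0 < e -> bnd (X - Y) e) -> X = Y.
Proof. by move=> h; apply/eqP; rewrite -subr_eq0; apply/eqP/bnd_eq0. Qed.

Definition selfadjoint X := adj X = X.

Lemma sa1 : selfadjoint 1. Proof. exact: adj1. Qed.

Lemma saD X Y : selfadjoint X -> selfadjoint Y -> selfadjoint (X + Y).
Proof. by rewrite /selfadjoint adjD => -> ->. Qed.

Lemma saB X Y : selfadjoint X -> selfadjoint Y -> selfadjoint (X - Y).
Proof. by rewrite /selfadjoint adjD adjN => -> ->. Qed.

Lemma saZ a X : selfadjoint X -> selfadjoint (a *: X).
Proof. by rewrite /selfadjoint adjZ => ->. Qed.

Lemma sa_gram X : selfadjoint (adj X * X).
Proof. by rewrite /selfadjoint !adjM adjK. Qed.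

Lemma saP X x y : selfadjoint X -> rip (X x) y = rip x (X y).
Proof. by rewrite adjP => ->. Qed.

(** For selfadjoint operators this amounts to invertibility, as [sa_bb_op_invertible] shows later;
    it is stable under products and needs no inverse to be constructed. *)
Definition bounded_below X :=
  exists2 c : R, 0 < c & forall x, c * nm x <= nm (X x).

Lemma bbM X Y : bounded_below X -> bounded_below Y -> bounded_below (X * Y).
Proof.
move=> [c c0 Xc] [d d0 Yd]; exists (c * d); first exact: mulr_gt0.
by move=> x; rewrite -mulrA bopM (le_trans _ (Xc _)) // ler_wpM2l ?(ltW c0).
Qed.

Lemma bb_coercive X c : 0 < c -> (forall x, c * nm x ^+ 2 <= rip (X x) x) ->
  bounded_below X.
Proof.
move=> c0 Xc; exists c => // x.
have := nm_ge0 x; rewrite le_eqVlt => /orP[/eqP<-|x0].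
  by rewrite mulr0 nm_ge0.
by rewrite -(ler_pM2r x0) -mulrA -expr2 (le_trans (Xc x)) // rip_le.
Qed.

Lemma bbZ a X : a != 0 -> bounded_below X -> bounded_below (a *: X).
Proof.
move=> a0 [c c0 Xc]; exists (`|a| * c); first by rewrite mulr_gt0 ?normr_gt0.
by move=> x; rewrite bopZ nmZ -mulrA ler_wpM2l.
Qed.

Lemma bb1 : bounded_below 1.
Proof. by exists 1 => // x; rewrite mul1r. Qed.

(** With [M = nrm X] and a lower bound [c], expanding the square of [|X^2 x - M^2 x|] and using
    [|X^2 x| <= M |X x|] gives [key]. Then [sqrt (M^4 - c^2) / M], which is smaller than [M], would
    bound [X]. *)
Lemma not_bb_sqr_nrm X : selfadjoint X -> (exists x : H, x != 0) ->
  ~ bounded_below (X * X - (nrm X ^+ 2) *: (1 : B)).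
Proof.
move=> Xsa [x0 x0n0] [c c0 Xc]; set M := nrm X in Xc.
have M0 : 0 <= M := nrm_ge0 X.
have nx0 : 0 < nm x0 by rewrite lt_neqAle nm_ge0 eq_sym nm_eq0 x0n0.
have key x : M ^+ 2 * nm (X x) ^+ 2 <= (M ^+ 4 - c ^+ 2) * nm x ^+ 2.
  have : (c * nm x) ^+ 2 <= nm ((X * X - M ^+ 2 *: (1 : B)) x) ^+ 2.
    by rewrite ler_pXn2r ?nnegrE ?nm_ge0 ?mulr_ge0 ?nm_ge0 ?(ltW c0).
  rewrite bopB bopZ bop1 bopM nm_sqrB nmZ ripZr (saP _ _ Xsa) ripxx.
  rewrite !exprMn real_normK ?num_real //.
  have : nm (X (X x)) ^+ 2 <= (M * nm (X x)) ^+ 2.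
    by rewrite ler_pXn2r ?nnegrE ?nm_ge0 ?mulr_ge0 ?nm_ge0 ?nrmP.
  rewrite !exprMn; lra.
have hM : c ^+ 2 <= M ^+ 4.
  have := le_trans _ (key x0); move/(_ 0);
    rewrite mulr_ge0 ?sqr_ge0 // => /(_ isT).
  by rewrite pmulr_lge0 ?exprn_gt0 // subr_ge0.
have M1 : 0 < M.
  rewrite lt_neqAle M0 andbT; apply/eqP => M00.
  move: hM; rewrite -M00 expr0n /=; have := exprn_gt0 2 c0; lra.
pose N := Num.sqrt (M ^+ 4 - c ^+ 2) / M.
have N0 : 0 <= N by rewrite divr_ge0 ?sqrtr_ge0.
have : M <= N.
  apply: nrm_le => // x.
  rewrite -(@ler_pXn2r _ 2) ?nnegrE ?nm_ge0 ?(mulr_ge0 N0 (nm_ge0 _)) //.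
  rewrite -(ler_pM2l (exprn_gt0 2 M1)) (le_trans (key x)) //.
  rewrite /N !exprMn exprVn sqr_sqrtr ?subr_ge0 // !mulrA (mulrC (M ^+ 2)).
  by rewrite mulfK ?lexx // expf_neq0 ?gt_eqF.
rewrite /N ler_pdivlMr // -expr2 -(@ler_pXn2r _ 2) ?nnegrE ?sqrtr_ge0 ?sqr_ge0
  //.
rewrite sqr_sqrtr ?subr_ge0 // -exprM; have := exprn_gt0 2 c0; lra.
Qed.

Definition hornerop p X : B := \sum_(i < size p) p`_i *: X ^+ i.

Lemma hp_widen p X n : (size p <= n)%N ->
  hornerop p X = \sum_(i < n) p`_i *: X ^+ i.
Proof.
move=> pn; rewrite /hornerop (big_ord_widen _ (fun i => p`_i *: X ^+ i) pn).
rewrite big_mkcond /=; apply: eq_bigr => i _; case: ltnP => // pi.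
by rewrite nth_default // scale0r.
Qed.

Lemma hpD p q X : hornerop (p + q) X = hornerop p X + hornerop q X.
Proof.
pose n := maxn (size p) (size q).
rewrite (@hp_widen _ _ n) ?size_polyD // (@hp_widen p _ n) ?leq_maxl //.
rewrite (@hp_widen q _ n) ?leq_maxr // -big_split /=.
by apply: eq_bigr => i _; rewrite coefD scalerDl.
Qed.

Lemma hpZ a p X : hornerop (a *: p) X = a *: hornerop p X.
Proof.
rewrite (@hp_widen _ _ (size p)) ?size_scale_leq // scaler_sumr.
by apply: eq_bigr => i _; rewrite coefZ scalerA.
Qed.

Lemma hpC a X : hornerop a%:P X = a *: (1 : B).
Proof.
by rewrite (@hp_widen _ _ 1) ?size_polyC_leq1 // big_ord1 coefC /= expr0.
Qed.

Lemma hp0 X : hornerop 0 X = 0.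
Proof. by rewrite -[0]/(0%:P) hpC scale0r. Qed.

Lemma hpMX p X : hornerop (p * 'X) X = hornerop p X * X.
Proof.
rewrite (@hp_widen _ _ (size p).+1) ?size_polyMX_leq //; last first.
  by rewrite (leq_trans (size_polyMleq _ _)) // size_polyX addn2.
rewrite big_ord_recl coefMX /= scale0r add0r /hornerop mulr_suml.
by apply: eq_bigr => i _; rewrite coefMX /= exprSr bopZAl.
Qed.

Lemma hpN p X : hornerop (- p) X = - hornerop p X.
Proof. by rewrite -scaleN1r hpZ scaleN1r. Qed.

Lemma hpB p q X : hornerop (p - q) X = hornerop p X - hornerop q X.
Proof. by rewrite hpD hpN. Qed.

Lemma hpX X : hornerop 'X X = X.
Proof. by rewrite -['X]mul1r hpMX -[1]/(1%:P) hpC scale1r mul1r. Qed.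

Lemma hpM p q X : hornerop (p * q) X = hornerop p X * hornerop q X.
Proof.
elim/poly_ind: q p => [|q a IH] p; first by rewrite mulr0 hp0 mulr0.
rewrite mulrDr mulrA !hpD !hpMX IH [p * _]mulrC mul_polyC hpZ hpC mulrDr mulrA.
by rewrite bopZAr mulr1.
Qed.

Lemma hpXn p X n : hornerop (p ^+ n) X = hornerop p X ^+ n.
Proof.
elim: n => [|n IH]; first by rewrite !expr0 -[1]/(1%:P) hpC scale1r.
by rewrite !exprS hpM IH.
Qed.

Lemma hp_sa p X : selfadjoint X -> selfadjoint (hornerop p X).
Proof.
move=> Xsa; elim/poly_ind: p => [|p c IH]; first by rewrite -[0]/(0%:P) hpC;
  apply/saZ/sa1.
rewrite hpD hpC; apply: saD; last exact/saZ/sa1.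
by rewrite /selfadjoint hpMX adjM IH Xsa -hpMX -{1}(hpX X) -hpM mulrC.
Qed.

(** The algebraic source of all later commutation arguments: the relation passes from polynomials to
    limits, hence to real powers. *)
Lemma hp_intertwine p X Y V : X * V = V * Y ->
  hornerop p X * V = V * hornerop p Y.
Proof.
move=> XVY; elim/poly_ind: p => [|p c IH]; first by rewrite !hp0 mul0r mulr0.
by rewrite !hpD !hpMX !hpC mulrDl mulrDr -mulrA XVY mulrA IH -mulrA bopZAl
  bopZAr mul1r mulr1.
Qed.

(* For selfadjoint [X] this is the whole spectrum ([spectrum_sap] below), but
   it requires no surjectivity argument. *)
Definition approx_spectrum X : set R :=
  [set a | ~ bounded_below (X - a *: (1 : B))].

Lemma complex_root p : (1 < size p)%N ->
  exists z : R[i], root (map_poly (real_complex R) p) z.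
Proof.
move=> p1; apply/closed_rootP.
by rewrite size_map_poly_id0 ?gtn_eqF // fmorph_eq0 lead_coef_eq0
  -size_poly_gt0 ltnW.
Qed.

(** Induction on the degree: a factor of [q] that is bounded below at [X] can be divided out.
    Conjugate pairs of nonreal roots give such factors, so a failing factor comes from a real
    root. *)
Lemma not_bb_hp q X :
  selfadjoint X -> q != 0 -> ~ bounded_below (hornerop q X) ->
  exists2 a, approx_spectrum X a & q.[a] = 0.
Proof.
move=> Xsa; have [n] := ubnP (size q); elim: n q => // n IH q qn q0 qnbb.
have [q1|q1] := leqP (size q) 1.
  move: q0 qnbb; rewrite (size1_polyC q1) polyC_eq0 hpC => q0 [];
    exact: bbZ bb1.
have [[al be] qz] := complex_root q1.
have [be0|be0] := eqVneq be 0.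
  have {}qz : root q al by move: qz; rewrite be0 complexr0 fmorph_root.
  have [|/(_ _)] := pselect (approx_spectrum X al); first by exists al => //;
    exact/rootP.
  move=> /contrapT bbX.
  have /factor_theorem [r rE] := qz.
  have r0 : r != 0 by apply: contraNneq q0 => r0; rewrite rE r0 mul0r.
  have [|//|rbb|a sa_a ra] := IH r.
  - move: qn; rewrite rE size_Mmonic ?monicXsubC // size_XsubC.
    by rewrite addn2 /= ltnS.
  - by apply: qnbb; rewrite rE hpM; apply: bbM => //; rewrite hpB hpX hpC.
  by exists a => //; rewrite rE hornerM ra mul0r.
pose d : {poly R} := ('X - al%:P) ^+ 2 + (be ^+ 2)%:P.
have sd : size d = 3%N.
  rewrite size_polyDl size_exp_XsubC // size_polyC.
  by case: (_ != _).
have d0 : d != 0 by rewrite -size_poly_gt0 sd.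
(* The remainder modulo [d] has degree at most one and vanishes at the nonreal point [al + i be];
   comparing imaginary and real parts kills both coefficients. *)
have dq : dvdp d q.
  have rs : (size (modp q d) < 3)%N by rewrite -sd ltn_modp.
  have : root (map_poly (real_complex R) (modp q d)) (al +i* be).
    move: qz; rewrite {1}(divp_eq q d) rmorphD rmorphM /= /root hornerD hornerM.
    suff -> : (map_poly (real_complex R) d).[al +i* be] = 0.
      by rewrite mulr0 add0r.
    rewrite /d rmorphD rmorphXn rmorphB /= map_polyX !map_polyC /= hornerD.
    rewrite horner_exp !hornerE /=.
    by apply/eqP; rewrite eq_complex /= !expr2 /=; apply/andP; split;
      apply/eqP; ring.
  rewrite /root (@horner_coef_wide _ 2) ?(leq_trans (size_poly _ _)) //.
  rewrite big_ord_recl big_ord1 /= !coef_map /= expr0 expr1 mulr1.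
  rewrite eq_complex /= !mul0r subr0 !addr0 add0r mulf_eq0 (negPf be0) orbF.
  move=> /andP[/eqP r0 /eqP r1]; move: r0; rewrite r1 mul0r addr0 => r0.
  apply/modp_eq0P/polyP => -[|[|i]]; rewrite coef0 ?r0 ?r1 // nth_default //.
  by rewrite -ltnS (leq_trans rs).
move: (dq) => /divpK qE; set r := divp q d in qE.
have r0 : r != 0 by apply: contraNneq q0 => r0; rewrite -qE r0 mul0r.
have [|//|rbb|a sa_a ra] := IH r.
- move: qn; rewrite -qE size_mul // sd addn3 /= ltnS => /ltnW.
  exact.
- apply: qnbb; rewrite -qE hpM; apply: bbM => //.
  (* [(X - al)^2] is the square of a selfadjoint operator, so adding [be^2] makes it coercive. *)
  apply: (@bb_coercive _ (be ^+ 2)); first by rewrite exprn_even_gt0.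
  move=> x; rewrite /d hpD hpXn hpB hpX !hpC bopD bopZ bop1 ripDl ripZl ripxx.
  rewrite lerDr; set Y := X - _.
  have Ysa : selfadjoint Y by apply: saB => //; apply/saZ/sa1.
  by rewrite expr2 bopM (saP _ _ Ysa) ripxx sqr_ge0.
by exists a => //; rewrite -qE hornerM ra mul0r.
Qed.

Lemma sap_attains_nrm X : selfadjoint X -> (exists x : H, x != 0) ->
  exists2 a, approx_spectrum X a & `|a| = nrm X.
Proof.
move=> Xsa Hn0; pose q : {poly R} := 'X ^+ 2 - (nrm X ^+ 2)%:P.
have [||a aX] := @not_bb_hp q X Xsa.
- by rewrite -size_poly_gt0 size_XnsubC.
- by rewrite hpB hpXn hpX hpC expr2; exact: not_bb_sqr_nrm.
rewrite !hornerE => /eqP; rewrite subr_eq0 eqf_sqr => /orP[]/eqP aE;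
  exists a => //.
  by rewrite aE ger0_norm ?nrm_ge0.
by rewrite aE normrN ger0_norm ?nrm_ge0.
Qed.

(** If [M = nrm (hornerop p X)] exceeded [e], then [p^2 - M^2] would have a zero on the approximate
    spectrum, where [|p| <= e < M]. *)
Lemma hp_bnd p X e : selfadjoint X -> 0 <= e ->
  (forall a, approx_spectrum X a -> `|p.[a]| <= e) -> bnd (hornerop p X) e.
Proof.
move=> Xsa e0 pe x; have [Me|Me] := lerP (nrm (hornerop p X)) e;
  first exact: bndW (nrmP _) x.
have [->|x0] := eqVneq x 0; first by rewrite raddf0 nm0 mulr0.
have Hn0 : exists x : H, x != 0 by exists x.
pose M := nrm (hornerop p X); pose q := p ^+ 2 - (M ^+ 2)%:P.
suff [a sa_a] : exists2 a, approx_spectrum X a & q.[a] = 0.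
  rewrite !hornerE => /eqP; rewrite subr_eq0 => /eqP pM.
  have : p.[a] ^+ 2 <= e ^+ 2.
    by rewrite -(real_normK (num_real _)) ler_pXn2r ?nnegrE ?pe.
  by rewrite pM leNgt ltr_pXn2r ?nnegrE ?Me // nrm_ge0.
(* When [q] is the zero polynomial every point is a root, and only nonemptiness of the approximate
   spectrum remains. *)
have [q0|q0] := eqVneq q 0.
  by have [a aX _] := sap_attains_nrm Xsa Hn0; exists a; rewrite // q0 horner0.
apply: not_bb_hp => //.
rewrite hpB hpXn hpC expr2; apply: not_bb_sqr_nrm => //; exact: hp_sa.
Qed.

End PolynomialCalculus.

(** * Uniform polynomial approximation of real powers *)

Section Approximation.
Variable R : realType.
Implicit Types (a b c e t : R) (f : R -> R).

(* The Bernstein polynomial of degree [n] of the values [g 0, ..., g n]: the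
   expectation of [g] at a binomial variable of parameters [n] and ['X]. *)
Fixpoint bernstein n (g : nat -> R) : {poly R} :=
  if n is n'.+1 then
    (1 - 'X) * bernstein n' g + 'X * bernstein n' (fun k => g k.+1)
  else (g 0%N)%:P.

Lemma bernstein_le n (g h : nat -> R) t : 0 <= t <= 1 ->
  (forall k, (k <= n)%N -> g k <= h k) ->
  (bernstein n g).[t] <= (bernstein n h).[t].
Proof.
move=> /andP[t0 t1]; elim: n g h => [|n IH] g h gh /=.
  by rewrite !hornerC gh.
rewrite !hornerE lerD // ler_wpM2l ?subr_ge0 //; apply: IH => k kn; apply: gh.
  exact: leqW.
by [].
Qed.

(** The first two moments of the binomial law: mean [n t] and variance [n t (1 - t)]. *)
Lemma bernstein_quad n a b c t :
  (bernstein n (fun k => a + b * k%:R + c * k%:R ^+ 2)).[t] =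
  a + b * (n%:R * t) + c * (n%:R * t * (1 - t) + (n%:R * t) ^+ 2).
Proof.
elim: n a b c => [|n IH] a b c /=; first by rewrite hornerC; ring.
rewrite hornerD !hornerM hornerD hornerN hornerX -[1]/(1%:P) hornerC IH.
have -> : (fun k : nat => a + b * k.+1%:R + c * k.+1%:R ^+ 2) =
   (fun k : nat => (a + b + c) + (b + 2 * c) * k%:R + c * k%:R ^+ 2).
  by apply/funext => k; rewrite -(natr1 k); ring.
by rewrite IH -(natr1 n); ring.
Qed.

(** Around each [t], [f] lies between the quadratics [f t -+ (e' + K (x - t)^2)]. Monotonicity and
    the exact values on quadratics bound the error by [e'] plus [K] times the variance of the
    binomial mean. *)
Lemma bernstein_approx f (L : R) e : 0 <= L -> 0 < e ->
  (forall x y : R, 0 <= x <= 1 -> 0 <= y <= 1 ->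
    `|f x - f y| <= L * `|x - y|) ->
  exists p : {poly R}, forall t, 0 <= t <= 1 -> `|p.[t] - f t| <= e.
Proof.
move=> L0 e0 fL.
pose e' := e / 2; have e'0 : 0 < e' by rewrite divr_gt0.
(* Chosen so that [L |x - y| <= e' + K (x - y)^2], an instance of [e' w <= e'^2 + w^2]. *)
pose K := L ^+ 2 / e'; have K0 : 0 <= K by rewrite divr_ge0 ?sqr_ge0 ?ltW.
have fK (x y : R) : 0 <= x <= 1 -> 0 <= y <= 1 ->
    `|f x - f y| <= e' + K * (x - y) ^+ 2.
  move=> x01 y01; apply: le_trans (fL _ _ x01 y01) _.
  rewrite -(ler_pM2l e'0) mulrDr.
  have -> : e' * (K * (x - y) ^+ 2) = L ^+ 2 * (x - y) ^+ 2.
    by rewrite /K; field; rewrite gt_eqF.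
  rewrite -(real_normK (num_real (x - y))) -exprMn.
  set w := L * _; have := sqr_ge0 (e' - w); have : 0 <= w by rewrite mulr_ge0.
  nra.
have [n nK] : exists n : nat, K < e' * n.+1%:R.
  have [n /(_ n (leqnn n))] := natSinv_small (divr_gt0 e'0 (ltr_wpDl K0 ltr01)).
  move=> h; exists n; move: h.
  rewrite invf_plt ?posrE ?ltr0n ?divr_gt0 ?ltr_wpDl //.
  by rewrite invf_div ltr_pdivrMr // mulrC; lra.
pose g k := f (k%:R / n.+1%:R); have n0 : 0 < n.+1%:R :> R by rewrite ltr0n.
exists (bernstein n.+1 g) => t t01.
have g01 k : (k <= n.+1)%N -> 0 <= (k%:R / n.+1%:R : R) <= 1.
  move=> kn; apply/andP; split; first by rewrite divr_ge0 ?ler0n.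
  by rewrite ler_pdivrMr // mul1r ler_nat.
(* The quadratic barriers at the nodes, upper for [s = 1] and lower for [s = -1], expanded in powers
   of [k] to match [bernstein_quad]. *)
pose Q s k : R := (f t + s * (e' + K * t ^+ 2)) + (s * - (2 * K * t / n.+1%:R))
  * k%:R
   + (s * (K / n.+1%:R ^+ 2)) * k%:R ^+ 2.
have QE s k : Q s k = f t + s * (e' + K * (k%:R / n.+1%:R - t) ^+ 2).
  by rewrite /Q; field; rewrite gt_eqF.
have QB s : (bernstein n.+1 (Q s)).[t] = f t + s * (e' + K * (t * (1 - t)) /
  n.+1%:R).
  by rewrite bernstein_quad; field; rewrite gt_eqF.
have Kn : K * (t * (1 - t)) / n.+1%:R <= e'.
  rewrite ler_pdivrMr //; apply: le_trans (ltW nK).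
  by rewrite -[leRHS]mulr1 ler_wpM2l //; have /andP[] := t01; nra.
rewrite ler_norml; apply/andP; split.
  have : (bernstein n.+1 (Q (-1))).[t] <= (bernstein n.+1 g).[t].
    apply: bernstein_le => // k kn; rewrite QE /g.
    by have := fK _ _ (g01 k kn) t01; rewrite ler_norml; set w := K * _;
      set v := f (_ / _) => /andP[]; lra.
  rewrite QB; move: Kn; rewrite /e'; set w := _ / n.+1%:R;
    set v := (bernstein _ _).[t]; lra.
have : (bernstein n.+1 g).[t] <= (bernstein n.+1 (Q 1)).[t].
  apply: bernstein_le => // k kn; rewrite QE /g.
  by have := fK _ _ (g01 k kn) t01; rewrite ler_norml; set w := K * _;
    set v := f (_ / _) => /andP[]; lra.
rewrite QB; move: Kn; rewrite /e'; set w := _ / n.+1%:R;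
  set v := (bernstein _ _).[t]; lra.
Qed.

Lemma lipschitz_approx f c (M L : R) e : c < M -> 0 <= L -> 0 < e ->
  (forall x y : R, c <= x <= M -> c <= y <= M ->
    `|f x - f y| <= L * `|x - y|) ->
  exists p : {poly R}, forall t, c <= t <= M -> `|p.[t] - f t| <= e.
Proof.
move=> cM L0 e0 fL; have w0 : 0 < M - c by rewrite subr_gt0.
have h01 x : 0 <= x <= 1 -> c <= c + (M - c) * x <= M.
  by move=> /andP[x0 x1]; apply/andP; split; nra.
have [|||p pf] := @bernstein_approx (fun x => f (c + (M - c) * x)) (L * (M -
  c)) e.
- by rewrite mulr_ge0 // ltW.
- exact: e0.
- move=> x y x01 y01; apply: le_trans (fL _ _ (h01 _ x01) (h01 _ y01)) _.
  have -> : c + (M - c) * x - (c + (M - c) * y) = (M - c) * (x - y) by ring.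
  by rewrite normrM (gtr0_norm w0) mulrA.
exists (p \Po ((M - c)^-1 *: ('X - c%:P))) => t tcM.
rewrite horner_comp !hornerE.
have := pf ((M - c)^-1 * (t - c)); rewrite mulrA divff ?gt_eqF // mul1r subrKC.
apply; move: tcM => /andP[ct tM].
rewrite mulrC; apply/andP; split; first by rewrite divr_ge0 ?subr_ge0 ?(ltW cM).
by rewrite ler_pdivrMr // mul1r lerD2r.
Qed.

Lemma expR_lipschitz (D x y : R) : x <= D -> y <= D ->
  `|expR x - expR y| <= expR D * `|x - y|.
Proof.
wlog yx : x y / y <= x.
  move=> h xD yD; have [yx|/ltW xy] := leP y x; first exact: h.
  by rewrite distrC (distrC x); apply: h.
move=> xD yD; rewrite !ger0_norm ?subr_ge0 ?ler_expR //.
apply: (@le_trans _ _ (expR x * (x - y))); last first.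
  by rewrite ler_wpM2r ?subr_ge0 // ler_expR.
have -> : expR y = expR x * expR (y - x) by rewrite -expRD subrKC.
have := expR_ge1Dx (y - x); have := expR_gt0 x; nra.
Qed.

(** [expR u >= 1 + u] at [u = ln x - ln y] gives [ln x - ln y <= (x - y) / y]. *)
Lemma ln_lipschitz c x y : 0 < c -> c <= x -> c <= y ->
  `|ln x - ln y| <= c^-1 * `|x - y|.
Proof.
move=> c0; wlog yx : x y / y <= x.
  move=> h cx cy; have [yx|/ltW xy] := leP y x; first exact: h.
  by rewrite distrC (distrC x); apply: h.
move=> cx cy; have y0 := lt_le_trans c0 cy; have x0 := lt_le_trans c0 cx.
rewrite !ger0_norm ?subr_ge0 ?ler_ln ?posrE //.
have := expR_ge1Dx (ln x - ln y); rewrite expRB !lnK ?posrE // => h.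
apply: (@le_trans _ _ (y^-1 * (x - y))).
  by rewrite mulrBr mulVf ?gt_eqF // [_ * x]mulrC; lra.
by rewrite ler_wpM2r ?subr_ge0 // lef_pV2 ?posrE.
Qed.

Lemma powRE a t : 0 < t -> t `^ a = expR (a * ln t).
Proof. by move=> t0; rewrite /powR gt_eqF. Qed.

Lemma ln_bounded c (M : R) : 0 < c ->
  exists2 D : R, 0 <= D & forall t, c <= t <= M -> `|ln t| <= D.
Proof.
move=> c0; exists (`|ln c| + `|ln M|) => [|t /andP[ct tM]];
  first exact: addr_ge0.
have t0 := lt_le_trans c0 ct.
have h1 : ln c <= ln t by rewrite ler_ln ?posrE.
have h2 : ln t <= ln M by rewrite ler_ln ?posrE // (lt_le_trans t0).
rewrite ler_norml; apply/andP; split.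
  by have := ler_norm (- ln c); rewrite normrN; have := normr_ge0 (ln M); lra.
by have := ler_norm (ln M); have := normr_ge0 (ln c); lra.
Qed.

Lemma powR_lipschitz a c (M : R) : 0 < c -> exists2 L : R, 0 <= L &
  forall x y : R, c <= x <= M -> c <= y <= M ->
    `|x `^ a - y `^ a| <= L * `|x - y|.
Proof.
move=> c0; have [D D0 lnD] := ln_bounded M c0.
exists (expR (`|a| * D) * (`|a| * c^-1)).
  by rewrite !mulr_ge0 ?expR_ge0 ?invr_ge0 ?(ltW c0).
move=> x y xcM ycM; have /andP[cx xM] := xcM; have /andP[cy yM] := ycM.
rewrite !powRE ?(lt_le_trans c0) //.
have aD z : c <= z <= M -> a * ln z <= `|a| * D.
  by move=> zcM; rewrite (le_trans (ler_norm _)) // normrM ler_wpM2l // lnD.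
apply: le_trans (expR_lipschitz (aD _ xcM) (aD _ ycM)) _.
rewrite -mulrA ler_wpM2l ?expR_ge0 // -mulrBr normrM -mulrA ler_wpM2l //.
exact: ln_lipschitz.
Qed.

(** Regularity in the exponent, uniform in the base: it later extends operator inequalities from
    dyadic to real exponents. *)
Lemma powR_exponent_lipschitz c (M : R) : 0 < c -> exists2 L : R, 0 <= L &
  forall a b t, 0 <= a <= 1 -> 0 <= b <= 1 -> c <= t <= M ->
  `|t `^ a - t `^ b| <= L * `|a - b|.
Proof.
move=> c0; have [D D0 lnD] := ln_bounded M c0.
exists (expR D * D); first by rewrite mulr_ge0 ?expR_ge0.
move=> a b t a01 b01 tcM;
  have t0 : 0 < t by case/andP: tcM => /(lt_le_trans c0).
rewrite !powRE //.
have aD z : 0 <= z <= 1 -> z * ln t <= D.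
  move=> /andP[z0 z1]; rewrite (le_trans (ler_norm _)) // normrM ger0_norm //.
  by rewrite -[D]mul1r ler_pM ?lnD.
apply: le_trans (expR_lipschitz (aD _ a01) (aD _ b01)) _.
by rewrite -mulrA ler_wpM2l ?expR_ge0 // -mulrBl normrM mulrC ler_wpM2r // lnD.
Qed.

Lemma powR_approx a c (M : R) e : 0 < c -> 0 < e ->
  exists p : {poly R}, forall t, c <= t <= M -> `|p.[t] - t `^ a| <= e.
Proof.
(* [M] may lie below [c]; the maximum makes the interval nondegenerate. *)
move=> c0 e0; have [L L0 aL] := powR_lipschitz a (Num.max M (c + 1)) c0.
have cM : c < Num.max M (c + 1) by rewrite lt_max ltrDl ltr01 orbT.
have [p pa] := lipschitz_approx cM L0 e0 aL.
by exists p => t /andP[ct tM]; apply: pa; rewrite ct le_max tM.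
Qed.

End Approximation.

(** * Continuous functional calculus on the approximate spectrum *)

Section FunctionalCalculus.
Variables (R : realType) (H : hilbertType R).
Local Notation B := (bop H).
Implicit Types (X Y Z S T V : B) (x y : H) (a b c e t : R) (p q : {poly R}).
Implicit Types (f g : R -> R).

Lemma bnd_lim X e : (forall d : R, 0 < d -> bnd X (e + d)) -> bnd X e.
Proof.
move=> h x; apply/ler_addgt0Pr => d d0.
have x1 : 0 < nm x + 1 by have := nm_ge0 x; lra.
apply: le_trans (h (d / (nm x + 1)) (divr_gt0 d0 x1) x) _.
rewrite mulrDl lerD2l mulrAC ler_pdivrMr // ler_wpM2l ?(ltW d0) //; lra.
Qed.

Lemma bndBC X Y e : bnd (X - Y) e -> bnd (Y - X) e.
Proof. by move=> /bndN; rewrite opprB. Qed.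

Lemma bndB_trans X Y Z e e' : bnd (X - Y) e -> bnd (Y - Z) e' ->
  bnd (X - Z) (e + e').
Proof. by move=> h h'; rewrite -(subrKA Y); apply: bndD. Qed.

Lemma nmZc (c : R[i]) x : nm (c *: x) = complex.Re `|c| * nm x.
Proof. by rewrite {1}/nm normrZ (nmE x) [_ * _%:C]mulrC cReM mulrC. Qed.

(** The limit is taken pointwise. The explicit rate in [uC] makes the convergence uniform, and
    linearity and boundedness pass to the limit. *)
Lemma bop_complete (u : nat -> B) :
  (forall i j, bnd (u i - u j) (i.+1%:R^-1 + j.+1%:R^-1)) ->
  exists S, forall i, bnd (u i - S) (2 * i.+1%:R^-1).
Proof.
move=> uC.
have /choice [s sP] : forall x, exists l, forall e : R, 0 < e -> exists N,
  forall i,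
    (N <= i)%N -> nm (u i x - l) <= e.
  move=> x; apply: nm_cauchy_cvg => e e0.
  have x1 : 0 < 2 * (nm x + 1) by have := nm_ge0 x; lra.
  have [N hN] := natSinv_small (divr_gt0 e0 x1); exists N => i j Ni Nj.
  have := uC i j x; rewrite bopB => h; apply: le_trans h _.
  have hi := hN _ Ni; have hj := hN _ Nj.
  apply: (@le_trans _ _ ((e / (2 * (nm x + 1)) + e / (2 * (nm x + 1))) * (nm x
    + 1))).
    apply: ler_pM; rewrite ?nm_ge0 ?addr_ge0 ?invr_ge0 ?ler0n //; last lra.
    by apply: lerD; apply: ltW.
  by rewrite le_eqVlt; apply/orP; left; apply/eqP; field; rewrite gt_eqF //;
    lra.
have s_near i x : nm (u i x - s x) <= 2 * i.+1%:R^-1 * nm x.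
  apply/ler_addgt0Pr => d d0.
  have [N hN] := sP x (d / 2) ltac:(lra).
  have x1 : 0 < 2 * (nm x + 1) by have := nm_ge0 x; lra.
  pose k := maxn N i.
  have -> : u i x - s x = (u i x - u k x) + (u k x - s x) by rewrite subrKA.
  apply: le_trans (nmD _ _) _; have := hN k (leq_maxl _ _).
  have := uC i k x; rewrite bopB.
  have : (i.+1%:R^-1 + k.+1%:R^-1) * nm x <= 2 * i.+1%:R^-1 * nm x.
    rewrite ler_wpM2r ?nm_ge0 //.
    have : k.+1%:R^-1 <= i.+1%:R^-1 :> R.
      by rewrite lef_pV2 ?posrE ?ltr0n // ler_nat ltnS leq_maxr.
    by move: (i.+1%:R^-1) (k.+1%:R^-1) => *; lra.
  move: (nm (_ - u k x)) (nm (u k x - _)) (nm x) (i.+1%:R^-1) (k.+1%:R^-1) =>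
    *; lra.
have s0 (z : H) (K : R) : (forall i, nm z <= i.+1%:R^-1 * K) -> z = 0.
  move=> h; apply/eqP; rewrite -nm_eq0 eq_le nm_ge0 andbT.
  apply/ler_addgt0Pr => e e0; rewrite add0r.
  have K1 : 0 < `|K| + 1 by have := normr_ge0 K; lra.
  have [N /(_ N (leqnn N)) hN] := natSinv_small (divr_gt0 e0 K1).
  apply: le_trans (h N) _; apply: (@le_trans _ _ (e / (`|K| + 1) * (`|K| + 1))).
    have K0 := normr_ge0 K.
    apply: (@le_trans _ _ (N.+1%:R^-1 * (`|K| + 1))).
      by rewrite ler_wpM2l ?invr_ge0 ?ler0n // (le_trans (ler_norm K)) // lerDl.
    by rewrite ler_wpM2r ?(ltW K1) ?(ltW hN).
  by rewrite divfK ?gt_eqF.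
have sl : linear s.
  (* The defect of linearity of [s] differs from that of [u i], which is zero, by at most
     [K / (i + 1)]. *)
  move=> c x y; apply/eqP; rewrite -subr_eq0; apply/eqP.
  pose K := 2 * (nm (c *: x + y) + complex.Re `|c| * nm x + nm y).
  apply: (s0 _ K) => i.
  have -> : s (c *: x + y) - (c *: s x + s y) = - (u i (c *: x + y) - s (c *: x
    + y))
     + (c *: (u i x - s x) + (u i y - s y)).
    by rewrite (linearP (u i)) scalerBr opprB (addrACA (c *: u i x)) -opprD
      subrKA.
  have h1 := nmD (- (u i (c *: x + y) - s (c *: x + y))) (c *: (u i x - s x) +
    (u i y - s y)).
  have h2 := nmD (c *: (u i x - s x)) (u i y - s y).
  rewrite nmN in h1; rewrite nmZc in h2.
  have c0 : 0 <= complex.Re `|c| by rewrite -ler0c RRe_real.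
  have h3 := s_near i (c *: x + y).
  have h4 := ler_wpM2l c0 (s_near i x).
  have h5 := s_near i y.
  rewrite /K; move: h1 h2 h3 h4 h5.
  move: (i.+1%:R^-1) => r; rewrite mulrCA; lra.
have sb : bounded_operator s.
  apply/bounded_operatorP; split=> //; exists (nrm (u 0) + 2).
    by rewrite addr_ge0 ?nrm_ge0.
  move=> x; rewrite -[s x](subrK (u 0 x)) addrC mulrDl (le_trans (nmD _ _)) //.
  by rewrite lerD ?nrmP // nmB (le_trans (s_near 0 x)) // invr1 mulr1.
by exists (Bop sb).
Qed.

(** One polynomial per tolerance replaces the sequences of [is_functional_calculus], which spares
    the algebra below any choice of indices. *)
Definition fcal X f S := forall e : R, 0 < e -> exists p,
  (forall a, approx_spectrum X a -> `|p.[a] - f a| <= e) /\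
  bnd (hornerop p X - S) e.

(** By [hp_bnd] polynomials close on the spectrum are close as operators, so any good approximant of
    [f] approximates [S]; uniqueness follows. *)
Lemma fcal_near X f S p e : selfadjoint X -> fcal X f S -> 0 <= e ->
  (forall a, approx_spectrum X a -> `|p.[a] - f a| <= e) ->
  bnd (hornerop p X - S) e.
Proof.
move=> Xsa fS e0 pf; apply: bnd_lim => d d0.
have [q [qf qS]] := fS (d / 2) ltac:(lra).
have -> : e + d = (e + d / 2) + d / 2 by lra.
apply: bndB_trans qS; rewrite -hpB; apply: hp_bnd => //; first lra.
move=> a aX; rewrite !hornerE -(subrKA (f a)).
by rewrite (le_trans (ler_normD _ _)) // lerD ?pf // distrC qf.
Qed.

Lemma fcal_unique X f S T : selfadjoint X -> fcal X f S -> fcal X f T -> S = T.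
Proof.
move=> Xsa fS fT; apply: bnd_unique => e e0.
have [p [pf pS]] := fS (e / 2) ltac:(lra).
have -> : e = e / 2 + e / 2 by lra.
apply: bndB_trans (bndBC pS) _; apply: (fcal_near Xsa fT) => //; lra.
Qed.

Lemma fcal_ext X f g S :
  (forall a, approx_spectrum X a -> f a = g a) -> fcal X f S -> fcal X g S.
Proof.
move=> fg fS e e0; have [p [pf pS]] := fS e e0; exists p; split=> // a aX.
by rewrite -fg ?pf.
Qed.

Lemma fcal_poly X p : fcal X (horner p) (hornerop p X).
Proof.
move=> e e0; exists p; split=> [a _|x]; first by rewrite subrr normr0 ltW.
by rewrite subrr bop0 nm0 mulr_ge0 ?nm_ge0 ?ltW.
Qed.

Lemma fcal_exists X f : selfadjoint X ->
  (forall e : R, 0 < e -> exists p,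
    forall a, approx_spectrum X a -> `|p.[a] - f a| <= e) ->
  exists S, fcal X f S.
Proof.
move=> Xsa fapp.
have /choice [p pf] : forall n : nat, exists p, forall a, approx_spectrum X a ->
    `|p.[a] - f a| <= n.+1%:R^-1.
  by move=> n; apply: fapp; rewrite invr_gt0 ltr0n.
have [i j|S hS] := @bop_complete (fun n => hornerop (p n) X).
  rewrite -hpB; apply: hp_bnd => // a aX.
  rewrite !hornerE -(subrKA (f a)).
  by rewrite (le_trans (ler_normD _ _)) // lerD ?pf // distrC pf.
exists S => e e0.
have [N /(_ N (leqnn N)) hN] := natSinv_small (divr_gt0 e0 (ltr0n R 2)).
exists (p N); split=> [a aX|]; last by apply: bndW (hS N); move: hN;
  move: (N.+1%:R^-1) => *; lra.
by apply: le_trans (pf _ _ aX) _; move: hN; move: (N.+1%:R^-1) => *; lra.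
Qed.

Lemma sap_le_nrm X a : approx_spectrum X a -> `|a| <= nrm X.
Proof.
move=> aX; rewrite leNgt; apply/negP => Xa; apply: aX.
exists (`|a| - nrm X) => [|x]; first lra.
rewrite bopB bopZ bop1 mulrBl -nmZ lerBlDr.
rewrite -{1}(subrK (X x) (a%:C *: x)) (le_trans (nmD _ _)) //.
by rewrite nmB lerD ?nrmP.
Qed.

(** Since [p - p(a)] is a multiple [r] of ['X - a], a lower bound for [p(X) - p(a)] divided by
    [nrm r(X) + 1] is one for [X - a]. *)
Lemma sap_hp X p a :
  approx_spectrum X a -> approx_spectrum (hornerop p X) p.[a].
Proof.
move=> aX [c c0 Yc]; apply: aX.
have /factor_theorem [r rE] : root (p - p.[a]%:P) a.
  by rewrite /root !hornerE subrr.
have YE : hornerop p X - p.[a] *: (1 : B) = hornerop r X * (X - a *: (1 : B)).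
  have -> : X - a *: (1 : B) = hornerop ('X - a%:P) X by rewrite hpB hpX hpC.
  by rewrite -hpM -rE hpB hpC.
have r0 := nrm_ge0 (hornerop r X).
exists (c / (nrm (hornerop r X) + 1)) => [|x]; first by rewrite divr_gt0 //;
  lra.
have := Yc x; rewrite YE bopM => /le_trans /(_ (nrmP _ _)) h.
have r1 : 0 < nrm (hornerop r X) + 1 by lra.
rewrite mulrAC ler_pdivrMr // (le_trans h) // mulrC ler_wpM2l ?nm_ge0 //; lra.
Qed.

Lemma sap_fcal X f S a :
  fcal X f S -> approx_spectrum X a -> approx_spectrum S (f a).
Proof.
move=> fS aX [c c0 Sc].
(* Replacing [S] by [p(X)] and [f a] by [p(a)] costs [c / 4] each, which leaves the lower bound
   [c / 2]. *)
have [p [pf pS]] := fS (c / 4) ltac:(lra).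
apply: (@sap_hp X p a aX); exists (c / 2) => [|x]; first lra.
rewrite bopB bopZ bop1; have := Sc x; rewrite bopB bopZ bop1.
have -> : S x - (f a)%:C *: x = (hornerop p X x - p.[a]%:C *: x) +
    ((S x - hornerop p X x) + (p.[a] - f a)%:C *: x).
  by rewrite rmorphB /= scalerBl addrACA addKr [hornerop p X x + _]addrC subrK.
move=> h; have h1 := le_trans h (nmD _ _).
have h2 := nmD (S x - hornerop p X x) ((p.[a] - f a)%:C *: x).
have h3 := bndBC pS x; rewrite bopB in h3.
have h4 : `|p.[a] - f a| * nm x <= c / 4 * nm x by rewrite ler_wpM2r ?nm_ge0
  ?pf.
rewrite nmZ in h2; lra.
Qed.

Lemma fcal_mul X f g S T : selfadjoint X -> fcal X f S -> fcal X g T ->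
  fcal X (fun a => f a * g a) (S * T).
Proof.
move=> Xsa fS gT e e0.
(* As [d <= 1], the product error [d * (nrm T + d) + nrm S * d] is at most [d * K <= e]. The same
   estimate serves the scalar functions, because [sap_fcal] bounds [f] and [g] on the spectrum by
   [nrm S] and [nrm T]. *)
pose K := nrm S + nrm T + 1.
have S0 := nrm_ge0 S; have T0 := nrm_ge0 T.
have K0 : 0 < K by rewrite /K; lra.
pose d := Num.min 1 (e / K).
have d0 : 0 < d by rewrite lt_min ltr01 divr_gt0.
have d1 : d <= 1 by rewrite ge_min lexx.
have de : d * K <= e by rewrite -ler_pdivlMr // ge_min lexx orbT.
have [p [pf pS]] := fS d d0; have [q [qg qT]] := gT d d0.
have dK u v w : 0 <= u -> u <= nrm S -> 0 <= v -> v <= nrm T + d -> w = d * v +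
  u * d -> w <= e.
  by move=> u0 uS v0 vT ->; apply: le_trans de; rewrite /K; nra.
exists (p * q); split=> [a aX|].
  rewrite hornerM.
  have -> : p.[a] * q.[a] - f a * g a = (p.[a] - f a) * q.[a] + f a * (q.[a] -
    g a) by ring.
  have fa := sap_le_nrm (sap_fcal fS aX);
    have ga := sap_le_nrm (sap_fcal gT aX).
  have qa : `|q.[a]| <= nrm T + d.
    by rewrite -(subrK (g a) q.[a]) (le_trans (ler_normD _ _)) // addrC lerD
      ?qg.
  rewrite (le_trans (ler_normD _ _)) // !normrM.
  apply: le_trans (dK _ _ _ (normr_ge0 _) fa (normr_ge0 _) qa (erefl _)).
  by rewrite lerD ?ler_wpM2r ?ler_wpM2l ?pf ?qg.
have -> : hornerop (p * q) X - S * T = (hornerop p X - S) * hornerop q X + S *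
  (hornerop q X - T).
  by rewrite mulrBl mulrBr hpM subrKA.
have qb : bnd (hornerop q X) (nrm T + d).
  by rewrite -(subrK T (hornerop q X)) addrC addrC [_ + d]addrC;
    apply: bndD => //; apply: nrmP.
apply: (@bndW _ _ _ (d * (nrm T + d) + nrm S * d)).
  by apply: (dK (nrm S) (nrm T + d)) => //; lra.
by apply: bndD; apply: bndM => //; [exact: ltW | exact: nrmP].
Qed.

Lemma fcal_sa X f S : selfadjoint X -> fcal X f S -> selfadjoint S.
Proof.
move=> Xsa fS; apply: (fcal_unique Xsa _ fS) => e e0.
have [p [pf pS]] := fS e e0; exists p; split=> //.
by rewrite -{1}(hp_sa p Xsa) -adjN -adjD; apply: bnd_adj.
Qed.

Lemma fcal_bnd X f S e : selfadjoint X -> fcal X f S -> 0 <= e ->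
  (forall a, approx_spectrum X a -> `|f a| <= e) -> bnd S e.
Proof.
move=> Xsa fS e0 fe; rewrite -[S]opprK; apply: bndN;
  rewrite -[- S]add0r -(hp0 X).
by apply: (fcal_near Xsa fS) => // a aX; rewrite horner0 sub0r normrN fe.
Qed.

Lemma fcal_sub X f g S T : fcal X f S -> fcal X g T ->
  fcal X (fun a => f a - g a) (S - T).
Proof.
move=> fS gT e e0; have e2 : 0 < e / 2 by lra.
have [p [pf pS]] := fS _ e2; have [q [qg qT]] := gT _ e2.
have E (V : zmodType) (u v w z : V) : u - v - (w - z) = (u - w) - (v - z).
  by rewrite !opprB addrACA [RHS]addrACA [- v - w]addrC.
exists (p - q); split=> [a aX|].
  rewrite !hornerE E (le_trans (ler_normB _ _)) // [leRHS]splitr.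
  by rewrite lerD ?pf ?qg.
by rewrite hpB E [X in bnd _ X]splitr; apply: bndD => //; apply: bndN.
Qed.

Lemma fcal_horner X f S p : selfadjoint X -> fcal X f S ->
  fcal X (fun a => p.[f a]) (hornerop p S).
Proof.
move=> Xsa fS; have cst c : fcal X (fun=> c) (c *: (1 : B)).
  by rewrite -(hpC c X); apply: fcal_ext (fcal_poly _ _) => a _;
    rewrite hornerC.
elim/poly_ind: p => [|p c IH].
  rewrite -[0]/(0%:P) hpC; apply: fcal_ext (cst 0) => a _; by rewrite hornerC.
rewrite -[c%:P]opprK -polyCN hpB hpMX hpC.
apply: fcal_ext (fcal_sub (fcal_mul Xsa IH fS) (cst (- c))) => a _.
by rewrite !hornerE.
Qed.

Lemma fcal_comp X f g S T : selfadjoint X -> fcal X f S -> fcal S g T ->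
  fcal X (fun a => g (f a)) T.
Proof.
move=> Xsa fS gT e e0; have e2 : 0 < e / 2 by lra.
have [q [qg qT]] := gT _ e2.
have [p [pf pS]] := fcal_horner q Xsa fS e2.
exists p; split=> [a aX|]; last by rewrite [e]splitr; apply: bndB_trans qT.
rewrite -(subrKA q.[f a]) (le_trans (ler_normD _ _)) // [leRHS]splitr.
by rewrite lerD ?pf // qg //; apply: sap_fcal aX.
Qed.

(** The same polynomial must approximate [f] on both spectra for [hp_intertwine] to apply, hence the
    joint approximation hypothesis. *)
Lemma fcal_intertwine X Y V f S T :
  selfadjoint X -> selfadjoint Y -> fcal X f S -> fcal Y f T ->
  (forall e : R, 0 < e -> exists p, forall a,
    approx_spectrum X a \/ approx_spectrum Y a -> `|p.[a] - f a| <= e) ->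
  X * V = V * Y -> S * V = V * T.
Proof.
move=> Xsa Ysa fS fT fapp XVY; apply: bnd_unique => e e0.
pose K := 2 * (nrm V + 1); have V0 := nrm_ge0 V.
have K0 : 0 < K by rewrite /K; lra.
have [p pf] := fapp _ (divr_gt0 e0 K0).
have pS : bnd (S - hornerop p X) (e / K).
  apply: bndBC; apply: fcal_near fS _ _; rewrite ?divr_ge0 ?ltW // => a aX.
  by apply: pf; left.
have pT : bnd (hornerop p Y - T) (e / K).
  apply: fcal_near fT _ _; rewrite ?divr_ge0 ?ltW // => a aX.
  by apply: pf; right.
have -> : S * V - V * T = (S - hornerop p X) * V + V * (hornerop p Y - T).
  by rewrite mulrBl mulrBr (hp_intertwine p XVY) subrKA.
apply: (@bndW _ _ _ (e / K * nrm V + nrm V * (e / K))); last first.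
  apply: bndD; apply: bndM => //;
    [by rewrite divr_ge0 ?ltW | exact: nrmP | exact: nrmP].
have -> : e / K * nrm V + nrm V * (e / K) = e * ((2 * nrm V) / K) by ring.
by rewrite -[leRHS]mulr1 ler_wpM2l ?(ltW e0) // ler_pdivrMr // mul1r /K; lra.
Qed.

End FunctionalCalculus.

(** * Real powers of positive invertible operators and the Loewner-Heinz inequality *)

Section Powers.
Variables (R : realType) (H : hilbertType R).
Local Notation B := (bop H).
Implicit Types (X Y Z S T V : B) (x y : H) (a b c e t : R) (p q : {poly R}).

(** Coercivity keeps the spectrum away from 0, so that powers with negative exponents are Lipschitz
    on it too. *)
Definition pos X := selfadjoint X /\
  exists2 c : R, 0 < c & forall x, c * nm x ^+ 2 <= rip (X x) x.

Lemma pos_sa X : pos X -> selfadjoint X. Proof. by case. Qed.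

Lemma pos_sap X : pos X ->
  exists c (M : R), 0 < c /\ forall a, approx_spectrum X a -> c <= a <= M.
Proof.
move=> [Xsa [c c0 Xc]]; exists c, (nrm X); split=> // a aX.
rewrite (le_trans (ler_norm a) (sap_le_nrm aX)) andbT leNgt; apply/negP => ac.
apply: aX; apply: (@bb_coercive _ _ _ (c - a)); first by rewrite subr_gt0.
by move=> x; rewrite bopB bopZ bop1 ripBl ripZl ripxx mulrBl lerB.
Qed.

Lemma pos_gram X : bounded_below X -> pos (adj X * X).
Proof.
move=> [c c0 Xc]; split; first exact: sa_gram.
exists (c ^+ 2) => [|x]; first exact: exprn_gt0.
rewrite bopM adjPl ripxx -exprMn ler_pXn2r ?nnegrE ?nm_ge0 //.
by rewrite mulr_ge0 ?nm_ge0 // ltW.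
Qed.

Definition pw X a : B := xget 0 [set S | fcal X (fun t => t `^ a) S].

Lemma pwP X a : pos X -> fcal X (fun t => t `^ a) (pw X a).
Proof.
move=> Xpos; have [c [M [c0 XcM]]] := pos_sap Xpos.
have [S XS] : exists S, fcal X (fun t => t `^ a) S.
  apply: fcal_exists; first exact: pos_sa.
  move=> e e0; have [p pa] := powR_approx a M c0 e0.
  by exists p => t tX; apply/pa/XcM.
by rewrite /pw; case: xgetP => [T _ //|/(_ S)].
Qed.

Lemma pw_unique X a S : pos X -> fcal X (fun t => t `^ a) S -> pw X a = S.
Proof. by move=> Xpos; apply: fcal_unique (pos_sa Xpos) (pwP a Xpos). Qed.

Lemma pw_sa X a : pos X -> selfadjoint (pw X a).
Proof. by move=> Xpos; apply: fcal_sa (pos_sa Xpos) (pwP a Xpos). Qed.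

Lemma sap_pos_gt0 X t : pos X -> approx_spectrum X t -> 0 < t.
Proof.
by move=> /pos_sap[c [M [c0 XcM]]] /XcM /andP[ct _]; apply: lt_le_trans ct.
Qed.

Lemma pw0 X : pos X -> pw X 0 = 1.
Proof.
move=> Xpos; apply: pw_unique => //.
have -> : (1 : B) = hornerop 1%:P X by rewrite hpC scale1r.
by apply: fcal_ext (fcal_poly _ _) => t _; rewrite hornerC powRr0.
Qed.

Lemma pw1 X : pos X -> pw X 1 = X.
Proof.
move=> Xpos; apply: pw_unique => //; rewrite -[X in fcal _ _ X]hpX.
apply: fcal_ext (fcal_poly _ _) => t tX; rewrite hornerX powRr1 // ltW //.
exact: sap_pos_gt0 tX.
Qed.

Lemma pwD X a b : pos X -> pw X (a + b) = pw X a * pw X b.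
Proof.
move=> Xpos; apply: pw_unique => //.
apply: fcal_ext (fcal_mul (pos_sa Xpos) (pwP a Xpos) (pwP b Xpos)) => t tX.
by rewrite powRD // (gt_eqF (sap_pos_gt0 Xpos tX)) implybT.
Qed.

Lemma pwVr X a : pos X -> pw X a * pw X (- a) = 1.
Proof. by move=> Xpos; rewrite -pwD // subrr pw0. Qed.

Lemma pwVl X a : pos X -> pw X (- a) * pw X a = 1.
Proof. by move=> Xpos; rewrite -pwD // addNr pw0. Qed.

Lemma pw_nat X n : pos X -> pw X n%:R = X ^+ n.
Proof.
move=> Xpos; elim: n => [|n IH]; first by rewrite pw0.
by rewrite -natr1 pwD // IH pw1 // exprSr.
Qed.

Lemma bb_linv X Y : Y * X = 1 -> bounded_below X.
Proof.
move=> YX; have Y0 := nrm_ge0 Y; have Y1 : 0 < nrm Y + 1 by lra.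
exists (nrm Y + 1)^-1 => [|x]; first by rewrite invr_gt0.
rewrite ler_pdivrMl // -[X in nm X](bop1 x) -YX bopM (le_trans (nrmP _ _)) //.
by rewrite ler_wpM2r ?nm_ge0 //; lra.
Qed.

Lemma bb_pw X a : pos X -> bounded_below (pw X a).
Proof. by move=> Xpos; apply: (@bb_linv _ (pw X (- a))); rewrite pwVl. Qed.

Lemma pw_half X a : pos X -> pw X a = adj (pw X (a / 2)) * pw X (a / 2).
Proof. by move=> Xpos; rewrite pw_sa // -pwD // -splitr. Qed.

Lemma pw_pos X a : pos X -> pos (pw X a).
Proof. by move=> Xpos; rewrite pw_half //; apply/pos_gram/bb_pw. Qed.

Lemma rip_pw X a x : pos X -> rip (pw X a x) x = nm (pw X (a / 2) x) ^+ 2.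
Proof. by move=> Xpos; rewrite pw_half // bopM adjPl ripxx. Qed.

Lemma pw_pw X a b : pos X -> pw (pw X a) b = pw X (a * b).
Proof.
move=> Xpos; apply/esym/pw_unique => //.
have := fcal_comp (pos_sa Xpos) (pwP a Xpos) (pwP b (pw_pos a Xpos)).
by apply: fcal_ext => t _; rewrite powRrM.
Qed.

Lemma pw_intertwine X Y V a : pos X -> pos Y -> X * V = V * Y ->
  pw X a * V = V * pw Y a.
Proof.
move=> Xpos Ypos; have [c [M [c0 XcM]]] := pos_sap Xpos.
have [d [N [d0 YdN]]] := pos_sap Ypos.
apply: fcal_intertwine (pos_sa Xpos) (pos_sa Ypos) (pwP a Xpos) (pwP a Ypos) _.
move=> e e0; have m0 : 0 < Num.min c d by rewrite lt_min c0.
have [p pa] := powR_approx a (Num.max M N) m0 e0.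
by exists p => t [/XcM|/YdN] /andP[ct tM]; apply: pa;
  rewrite ge_min le_max ct tM ?orbT.
Qed.

Lemma pw_lipschitz X : pos X -> exists2 L : R, 0 <= L &
  forall a b, 0 <= a <= 1 -> 0 <= b <= 1 ->
    bnd (pw X a - pw X b) (L * `|a - b|).
Proof.
move=> Xpos; have [c [M [c0 XcM]]] := pos_sap Xpos.
have [L L0 LP] := powR_exponent_lipschitz M c0; exists L => // a b a01 b01.
apply: fcal_bnd (pos_sa Xpos) (fcal_sub (pwP a Xpos) (pwP b Xpos)) _ _.
  exact: mulr_ge0.
by move=> t tX; apply: LP => //; apply: XcM.
Qed.

(** Only real parts are compared; for selfadjoint operators this agrees with [op_le]. *)
Definition ole X Y := forall x, rip (X x) x <= rip (Y x) x.

Lemma ole_trans X Y Z : ole X Y -> ole Y Z -> ole X Z.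
Proof. by move=> XY YZ x; apply: le_trans (XY x) (YZ x). Qed.

Lemma ole_conj X Y V : ole X Y -> ole (adj V * X * V) (adj V * Y * V).
Proof. by move=> XY x; rewrite !bopM !adjPl. Qed.

(** Both sides compare [|X^(a/2) x|] with [|Y^(a/2) x|], through the substitution of [Y^(-a/2) x]
    for [x]. The order becomes a norm bound, which can be multiplied and adjoined. *)
Lemma ole_pwP X Y a : pos X -> pos Y ->
  ole (pw X a) (pw Y a) <-> bnd (pw X (a / 2) * pw Y (- (a / 2))) 1.
Proof.
move=> Xpos Ypos; split=> h x.
  rewrite mul1r -(@ler_pXn2r _ 2) ?nnegrE ?nm_ge0 //.
  rewrite bopM -rip_pw // (le_trans (h _)) // rip_pw //.
  by rewrite -bopM pwVr // bop1.
rewrite !rip_pw // ler_pXn2r ?nnegrE ?nm_ge0 //.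
have -> : pw X (a / 2) x = (pw X (a / 2) * pw Y (- (a / 2))) (pw Y (a / 2) x).
  by rewrite -bopM -mulrA pwVl // mulr1.
by rewrite -[leRHS]mul1r h.
Qed.

Lemma ole_pw_adjP X Y a : pos X -> pos Y ->
  ole (pw X a) (pw Y a) <-> bnd (pw Y (- (a / 2)) * pw X (a / 2)) 1.
Proof.
move=> Xpos Ypos; rewrite ole_pwP //.
by split=> /bnd_adj; rewrite adjM !pw_sa.
Qed.

Lemma ole_pwN X Y a : pos X -> pos Y ->
  ole (pw X a) (pw Y a) -> ole (pw Y (- a)) (pw X (- a)).
Proof.
by move=> Xpos Ypos /ole_pw_adjP h; apply/ole_pwP => //; rewrite mulNr opprK;
  apply: h.
Qed.

(* [J] below is similar to a product of the two contractions given by the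
   hypotheses, and a selfadjoint operator attains its norm on its approximate
   spectrum, which is invariant under similarity. *)
Lemma ole_pw_mid X Y a b : pos X -> pos Y ->
  ole (pw X a) (pw Y a) -> ole (pw X b) (pw Y b) ->
  ole (pw X ((a + b) / 2)) (pw Y ((a + b) / 2)).
Proof.
move=> Xpos Ypos /ole_pw_adjP Ha /ole_pwP Hb.
have {}Ha := Ha Xpos Ypos; have {}Hb := Hb Xpos Ypos.
set h := (a + b) / 2.
pose J := pw Y (- (h / 2)) * pw X h * pw Y (- (h / 2)).
have Jsa : selfadjoint J.
  by rewrite /selfadjoint /J !adjM !pw_sa // mulrA.
have J1 : bnd J 1.
  move=> x; have [->|x0] := eqVneq x 0; first by rewrite raddf0 nm0 mulr0.
  have [|l lJ Jl] := sap_attains_nrm Jsa; first by exists x.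
  apply: (@bndW _ _ _ (nrm J)); last exact: nrmP.
  pose K := pw Y (- (a / 2)) * pw X (a / 2) * (pw X (b / 2) * pw Y (- (b / 2))).
  have K1 : nrm K <= 1.
    by apply: nrm_le => //; rewrite -[1]mulr1; apply: bndM.
  rewrite -Jl (le_trans _ K1) //; apply: sap_le_nrm => bbK; apply: lJ.
  pose c := a / 2 - h / 2.
  (* The similarity by [Y^c] shifts the outer exponents [-a/2] and [-b/2] of [K] to the common value
     [-h/2] and fixes multiples of 1. *)
  suff -> : J - l *: (1 : B) = pw Y c * (K - l *: (1 : B)) * pw Y (- c).
    by apply: bbM; [apply: bbM => // |]; apply: bb_pw.
  rewrite mulrBr mulrBl bopZAr mulr1 bopZAl pwVr //; congr (_ - _).
  rewrite /K /J !mulrA -pwD // -!mulrA -pwD // [pw X (a / 2) * _]mulrA -pwD //.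
  by congr (pw Y _ * (pw X _ * pw Y _)); rewrite /c /h; lra.
move=> x; rewrite [in leRHS]rip_pw // -ripxx.
have -> : pw X h = pw Y (h / 2) * J * pw Y (h / 2).
  rewrite /J -!mulrA pwVl // mulr1 !mulrA pwVr // mul1r //.
rewrite !bopM -{1}[pw Y (h / 2)](pw_sa _ Ypos) adjPl.
set z := pw Y (h / 2) x; apply: le_trans (rip_le _ _) _.
by rewrite ripxx expr2 ler_wpM2r ?nm_ge0 // (le_trans (J1 z)) // mul1r.
Qed.

(** Bisection: [k / 2^(n+1)] is the midpoint of the two fractions over [2^n] whose numerators are
    [k / 2] rounded down and up. *)
Lemma loewner_heinz_dyadic X Y n k : pos X -> pos Y -> ole X Y ->
  (k <= 2 ^ n)%N -> ole (pw X (k%:R / 2 ^+ n)) (pw Y (k%:R / 2 ^+ n)).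
Proof.
move=> Xpos Ypos XY; elim: n k => [|n IH] k kn.
  rewrite expr0 divr1; case: k kn => [|[|k]] // _; first by rewrite !pw0.
  by rewrite !pw1.
have -> : k%:R / 2 ^+ n.+1 = (k./2%:R / 2 ^+ n + (uphalf k)%:R / 2 ^+ n) / 2 :>
  R.
  rewrite -mulrDl -natrD uphalf_half addnCA addnn odd_double_half.
  by rewrite exprSr invfM mulrA.
apply: ole_pw_mid => //; apply: IH; move: kn; rewrite expnS mul2n.
  by move=> /half_leq; rewrite doubleK.
by move=> /uphalf_leq; rewrite uphalf_double.
Qed.

Lemma loewner_heinz X Y a : pos X -> pos Y -> ole X Y -> 0 <= a <= 1 ->
  ole (pw X a) (pw Y a).
Proof.
move=> Xpos Ypos XY a01 x; have /andP[a0 a1] := a01.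
have [L L0 XL] := pw_lipschitz Xpos; have [N N0 YN] := pw_lipschitz Ypos.
apply/ler_addgt0Pr => e e0.
pose C := (L + N) * nm x ^+ 2 + 1.
have LN0 : 0 <= (L + N) * nm x ^+ 2 by rewrite mulr_ge0 ?addr_ge0 ?sqr_ge0.
have C0 : 0 < C by rewrite /C; lra.
have [n /(_ n (leqnn n)) hn] := natSinv_small (divr_gt0 e0 C0).
have n0 : 0 < 2 ^+ n :> R by rewrite exprn_gt0.
(* [d] is [a] truncated to [n] binary digits, so [0 <= a - d <= 2^-n <= 1 / (n + 1)]. *)
pose k := Num.truncn (a * 2 ^+ n); pose d : R := k%:R / 2 ^+ n.
have /andP[k1 k2] : k%:R <= a * 2 ^+ n < k.+1%:R.
  by apply: truncn_itv; rewrite mulr_ge0 ?(ltW n0).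
have d0 : 0 <= d by rewrite divr_ge0 ?ler0n ?(ltW n0).
have da : d <= a by rewrite ler_pdivrMr.
have d01 : 0 <= d <= 1 by rewrite d0 (le_trans da).
have ad : `|a - d| <= n.+1%:R^-1.
  rewrite ger0_norm ?subr_ge0 //.
  apply: (@le_trans _ _ (2 ^+ n)^-1).
    rewrite -(ler_pM2r n0) mulrBl divfK ?mulVf ?gt_eqF //.
    by rewrite lerBlDr addrC natr1 ltW.
  rewrite lef_pV2 ?posrE ?ltr0n // -natrX ler_nat; exact: ltn_expl.
have kn : (k <= 2 ^ n)%N.
  by rewrite -(ler_nat R) natrX (le_trans k1) // ler_piMl ?(ltW n0).
have XYd : rip (pw X d x) x <= rip (pw Y d x) x := loewner_heinz_dyadic Xpos
  Ypos XY kn x.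
have X1 : rip ((pw X a - pw X d) x) x <= L * n.+1%:R^-1 * nm x ^+ 2.
  rewrite (le_trans (rip_le _ _)) // expr2 mulrA ler_wpM2r ?nm_ge0 //.
  rewrite (le_trans (XL _ _ a01 d01 x)) // ler_wpM2r ?nm_ge0 //.
  by rewrite ler_wpM2l.
have Y1 : rip ((pw Y d - pw Y a) x) x <= N * n.+1%:R^-1 * nm x ^+ 2.
  rewrite (le_trans (rip_le _ _)) // expr2 mulrA ler_wpM2r ?nm_ge0 //.
  rewrite (le_trans (YN _ _ d01 a01 x)) // ler_wpM2r ?nm_ge0 //.
  by rewrite ler_wpM2l // distrC.
rewrite !bopB !ripBl in X1 Y1.
have : n.+1%:R^-1 * C <= e by rewrite -ler_pdivlMr // ltW.
have : 0 <= n.+1%:R^-1 :> R by rewrite invr_ge0 ler0n.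
move: X1 Y1; rewrite /C; move: (n.+1%:R^-1) => r; nra.
Qed.

End Powers.

(** * Furuta type inequalities *)

Section Furuta.
Variables (R : realType) (H : hilbertType R).
Local Notation B := (bop H).
Implicit Types (X Y Z S T V E W : B) (a b c d p r : R).

Lemma ole_pw_conj S X Y a : pos S -> ole X Y ->
  ole (pw S a * X * pw S a) (pw S a * Y * pw S a).
Proof. by move=> Spos XY; rewrite -{1 3}(pw_sa a Spos); apply: ole_conj. Qed.

Lemma ole_inv X Y a b : pos X -> pos Y ->
  ole (pw X a) (pw Y b) -> ole (pw Y (- b)) (pw X (- a)).
Proof.
move=> Xpos Ypos XY; have Xa := pw_pos a Xpos; have Yb := pw_pos b Ypos.
have := @ole_pwN _ _ _ _ 1 Xa Yb.
by rewrite (pw1 Xa) (pw1 Yb) (pw_pw _ _ Xpos) (pw_pw _ _ Ypos) !mulrN1; apply.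
Qed.

(** Loewner-Heinz for the operators [X^a] and [Y^b]; the new exponents are separate variables so
    that their simplified forms can be supplied. *)
Lemma ole_pw_mul X Y a b c a' b' : pos X -> pos Y -> 0 <= c <= 1 ->
  a' = a * c -> b' = b * c ->
  ole (pw X a) (pw Y b) -> ole (pw X a') (pw Y b').
Proof.
move=> Xpos Ypos c01 -> -> XY; rewrite -(pw_pw a c Xpos) -(pw_pw b c Ypos).
by apply: loewner_heinz => //; apply: pw_pos.
Qed.

Lemma ler_div01 a b : 0 <= a -> a <= b -> 0 <= a / b <= 1.
Proof.
move=> a0 ab; have b0 := le_trans a0 ab; rewrite divr_ge0 //=.
move: b0; rewrite le_eqVlt => /orP[/eqP<-|b0]; first by rewrite invr0 mulr0.
by rewrite ler_pdivrMr // mul1r.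
Qed.

(** The outer exponent is halved so that [a] and [b] are the total degrees in [S] and [T]. *)
Definition sandwich S a T b : B := pw S (a / 2) * pw T b * pw S (a / 2).

Lemma sandwich_gram S a T b : pos S -> pos T ->
  sandwich S a T b =
  adj (pw T (b / 2) * pw S (a / 2)) * (pw T (b / 2) * pw S (a / 2)).
Proof.
move=> Spos Tpos; rewrite adjM !pw_sa // /sandwich.
by rewrite [in LHS](splitr b) pwD // !mulrA.
Qed.

Lemma sandwich_pos S a T b : pos S -> pos T -> pos (sandwich S a T b).
Proof.
by move=> Spos Tpos; rewrite sandwich_gram //; apply/pos_gram/bbM; apply: bb_pw.
Qed.

Lemma sandwich_comp S a d T b : pos S ->
  pw S (d / 2) * sandwich S a T b * pw S (d / 2) = sandwich S (a + d) T b.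
Proof.
move=> Spos; rewrite /sandwich.
have E1 : pw S ((a + d) / 2) = pw S (d / 2) * pw S (a / 2).
  by rewrite -pwD // -mulrDl addrC.
have E2 : pw S ((a + d) / 2) = pw S (a / 2) * pw S (d / 2).
  by rewrite -pwD // -mulrDl.
by rewrite [in RHS]E2 -E2 {1}E1 E2 !mulrA.
Qed.

(** For [Z = T^(b/2) S^(a/2)] the two sandwiches are [adj Z * Z] and [Z * adj Z], intertwined by
    [adj Z]. An outer exponent in [[0, 1]] thereby becomes a nonpositive inner one, to which order
    reversal applies. *)
Lemma sandwich_swap S a T b c : pos S -> pos T ->
  pw (sandwich S a T b) (c + 1) =
  pw S (a / 2) * (pw T (b / 2) * pw (sandwich T b S a) c * pw T (b / 2)) *
  pw S (a / 2).
Proof.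
move=> Spos Tpos; set Z := pw T (b / 2) * pw S (a / 2).
have adjZ : adj Z = pw S (a / 2) * pw T (b / 2) by rewrite adjM !pw_sa.
have -> : sandwich S a T b = adj Z * Z by rewrite sandwich_gram.
have -> : sandwich T b S a = Z * adj Z.
  by rewrite sandwich_gram // -adjZ adjK.
have Zpos : pos (adj Z * Z) by rewrite -sandwich_gram //; apply: sandwich_pos.
have Zpos' : pos (Z * adj Z).
  by rewrite -[Z in Z * _]adjK adjZ -sandwich_gram //; apply: sandwich_pos.
have ZI := pw_intertwine c Zpos Zpos' (esym (mulrA (adj Z) Z (adj Z))).
by rewrite pwD // (pw1 Zpos) mulrA ZI adjZ /Z !mulrA.
Qed.

(** The form of Furuta's inequality which, when required for all positive [p] and [r], characterizes
    the chaotic order [log T <= log E]. *)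
Definition furuta_le E T p r :=
  ole (pw (sandwich E r T p) (r / (p + r))) (pw E r).

(** The hypothesis gives [T^(p+r) <= T^(p/2) E^r T^(p/2)]; the power [p / (p + r)] and inversion
    bound the inner factor produced by [sandwich_swap] by [T^(-p)], which cancels. *)
Lemma furuta_le_base E T p r : pos E -> pos T -> 0 < p -> 0 < r ->
  ole (pw T r) (pw E r) -> furuta_le E T p r.
Proof.
move=> Epos Tpos p0 r0 TE; have pr0 : 0 < p + r by rewrite addr_gt0.
rewrite /furuta_le.
have -> : r / (p + r) = - (p / (p + r)) + 1 by field; rewrite gt_eqF.
rewrite sandwich_swap //.
have h1 : ole (pw T (p + r)) (sandwich T p E r).
  have -> : p + r = p / 2 + r + p / 2 by field.
  by rewrite !pwD //; apply: ole_pw_conj.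
have prpos := sandwich_pos p r Tpos Epos.
rewrite -(pw1 prpos) in h1.
have h2 : ole (pw T p) (pw (sandwich T p E r) (p / (p + r))).
  apply: (ole_pw_mul (c := p / (p + r)) Tpos prpos _ _ _ h1).
  - by rewrite ler_div01 ?lerDl ?(ltW r0) ?(ltW p0).
  - by field; rewrite gt_eqF.
  - by rewrite mul1r.
have h3 := ole_pw_conj (r / 2) Epos (ole_pw_conj (p / 2) Tpos (ole_inv Tpos
  prpos h2)).
apply: ole_trans h3 _; rewrite -!pwD //.
have -> : p / 2 - p + p / 2 = 0 by field.
by rewrite pw0 // mulr1 -pwD // -splitr.
Qed.

(** The argument of the base case with [W] in place of [T]: the assumed inequality, raised to
    [d / r <= 1], compares [W^(d/(p+r))] with [E^d], and is used once more at full strength at the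
    end. *)
Lemma furuta_le_step E T p r d :
  pos E -> pos T -> 0 < p -> 0 < r -> 0 <= d <= r ->
  furuta_le E T p r -> furuta_le E T p (r + d).
Proof.
move=> Epos Tpos p0 r0 /andP[d0 dr] ErT; set W := sandwich E r T p in ErT.
have Wpos : pos W := sandwich_pos r p Epos Tpos.
have pr0 : 0 < p + r by rewrite addr_gt0.
have prd0 : 0 < p + r + d by rewrite ltr_wpDr.
have WE : sandwich E (r + d) T p = sandwich E d W 1.
  by rewrite -sandwich_comp // /sandwich pw1.
rewrite /furuta_le WE.
have -> : (r + d) / (p + (r + d)) = - (p / (p + r + d)) + 1.
  by rewrite addrA; field; rewrite gt_eqF.
rewrite sandwich_swap //.
have Vpos := sandwich_pos 1 d Wpos Epos.
have h1 : ole (pw W (d / (p + r))) (pw E d).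
  apply: (ole_pw_mul (c := d / r) Wpos Epos _ _ _ ErT).
  - exact: ler_div01.
  - by field; rewrite !gt_eqF.
  - by field; rewrite gt_eqF.
have h2 : ole (pw W ((p + r + d) / (p + r))) (sandwich W 1 E d).
  have -> : (p + r + d) / (p + r) = 1 / 2 + d / (p + r) + 1 / 2.
    by field; rewrite gt_eqF.
  by rewrite !pwD //; apply: ole_pw_conj.
rewrite -(pw1 Vpos) in h2.
have h3 : ole (pw W (p / (p + r))) (pw (sandwich W 1 E d) (p / (p + r + d))).
  apply: (ole_pw_mul (c := p / (p + r + d)) Wpos Vpos _ _ _ h2).
  - by rewrite ler_div01 ?(ltW p0) // -addrA lerDl addr_ge0 // ltW.
  - by field; rewrite !gt_eqF.
  - by rewrite mul1r.
have h4 := ole_pw_conj (d / 2) Epos (ole_pw_conj (1 / 2) Wpos (ole_inv Wpos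
  Vpos h3)).
apply: ole_trans h4 _; rewrite -!(pwD _ _ Wpos).
have -> : 1 / 2 - p / (p + r) + 1 / 2 = r / (p + r) by field; rewrite gt_eqF.
have -> : r + d = d / 2 + r + d / 2 by field.
by rewrite !(pwD _ _ Epos); apply: ole_pw_conj.
Qed.

(* Instances of Furuta's inequality: the step lengths [d <= r] double the
   admissible range, so unit steps reach every larger integer. *)
Lemma furuta_le_nat E T p n i : pos E -> pos T -> 0 < p -> (0 < n)%N ->
  ole (pw T n%:R) (pw E n%:R) -> furuta_le E T p (n + i)%:R.
Proof.
move=> Epos Tpos p0 n0 TE; elim: i => [|i IH].
  by rewrite addn0; apply: furuta_le_base; rewrite ?ltr0n.
rewrite addnS -natr1; apply: furuta_le_step => //.
  by rewrite ltr0n addn_gt0 n0.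
by rewrite ler01 ler1n addn_gt0 n0.
Qed.

(** After [sandwich_swap] the right side contains [W^(-p/(p+q))] with [W = E^(q/2) T^p E^(q/2)].
    Raising the Furuta inequality to [p / q] and inverting bounds this below by [E^(-p)]. *)
Lemma furuta_sandwich E T p q : pos E -> pos T -> 0 < p -> p <= q ->
  furuta_le E T p q ->
  ole (sandwich T p E (q - p)) (pw (sandwich T p E q) (q / (q + p))).
Proof.
move=> Epos Tpos p0 pq EqT; have q0 := lt_le_trans p0 pq.
have pq0 : 0 < p + q by rewrite addr_gt0.
have -> : q / (q + p) = - (p / (p + q)) + 1 by rewrite [q + p]addrC; field;
  rewrite gt_eqF.
rewrite sandwich_swap //.
have Wpos := sandwich_pos q p Epos Tpos.
have h : ole (pw (sandwich E q T p) (p / (p + q))) (pw E p).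
  apply: (ole_pw_mul (c := p / q) Wpos Epos _ _ _ EqT).
  - by rewrite ler_div01 ?(ltW p0).
  - by field; rewrite !gt_eqF.
  - by field; rewrite gt_eqF.
apply: ole_pw_conj => //.
have -> : q - p = q / 2 - p + q / 2 by field.
rewrite !(pwD _ _ Epos); apply: ole_pw_conj => //.
exact: ole_inv.
Qed.

End Furuta.

(** * Agreement of the bundled calculus with the definitions of the statement *)

Section Bridge.
Variables (R : realType) (H : hilbertType R).
Local Notation B := (bop H).
Implicit Types (X Y Z S T V : B) (a b e t : R).

Lemma bop_sum I (r : seq I) (P : pred I) (F : I -> B) (x : H) :
  (\sum_(i <- r | P i) F i) x = \sum_(i <- r | P i) F i x.
Proof. exact: (big_morph (fun X : B => X x)). Qed.

Lemma op_hornerE (p : {poly R}) X x : op_horner p X x = hornerop p X x.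
Proof.
by rewrite bop_sum; apply: eq_bigr => i _; rewrite bopZ -bop_iter.
Qed.

Lemma op_invertible_bop X :
  op_invertible X <-> exists2 Y : B, Y * X = 1 & X * Y = 1.
Proof.
split=> [[f [fb Xf fX]]|[Y YX XY]].
  by exists (Bop fb); apply: bop_ext => x; [apply: Xf | apply: fX].
exists Y; split; first exact: bopP.
  by move=> x; rewrite -bopM YX.
by move=> x; rewrite -bopM XY.
Qed.

Lemma op_invertible_bb X : op_invertible X -> bounded_below X.
Proof. by case/op_invertible_bop => Y YX _; apply: bb_linv YX. Qed.

(** [X^2] is positive and coercive, hence invertible by its power -1. Since [X] commutes with that
    power, [X (X^2)^(-1)] is a two-sided inverse. *)
Lemma sa_bb_op_invertible X :
  selfadjoint X -> bounded_below X -> op_invertible X.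
Proof.
move=> Xsa Xbb; have XXpos : pos (X * X) by rewrite -{1}Xsa; apply: pos_gram.
have XXV : X * X * pw (X * X) (- 1) = 1 by rewrite -{1}(pw1 XXpos) pwVr.
apply/op_invertible_bop; exists (X * pw (X * X) (- 1)); last by rewrite mulrA.
by rewrite -(pw_intertwine _ XXpos XXpos) -?mulrA // -{2}(pw1 XXpos) pwVl.
Qed.

Lemma spectrum_sap X t :
  selfadjoint X -> spectrum X t%:C <-> approx_spectrum X t.
Proof.
move=> Xsa; rewrite /spectrum /approx_spectrum /=.
have -> : (fun x => X x - t%:C *: x) = X - t *: (1 : B) by [].
split=> h h'; apply: h.
  by apply: sa_bb_op_invertible => //; apply: saB => //; apply/saZ/sa1.
exact: op_invertible_bb.
Qed.

(** As [op_powR] picks an arbitrary witness, two facts are needed: [fcX] identifies every witness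
    with [pw X a], and [ex] provides one. *)
Lemma op_powRE X a : pos X -> op_powR X a = pw X a.
Proof.
move=> Xpos; have Xsa := pos_sa Xpos.
have fcX (S : H -> H) : is_functional_calculus (fun t => t `^ a) X S -> S = pw
  X a.
  move=> [p [pa pS]]; apply/funext => x; apply/eqP; rewrite -subr_eq0 -nm_eq0.
  rewrite eq_le nm_ge0 andbT; apply/ler_addgt0Pr => e e0; rewrite add0r.
  have x1 : 0 < 2 * (nm x + 1) by have := nm_ge0 x; lra.
  have d0 := divr_gt0 e0 x1; set d := e / _ in d0.
  have [M _ hM] := pa d d0; have [N _ hN] := pS d d0.
  pose k := maxn M N.
  have h1 := hM k (leq_maxl _ _); have h2 := hN k (leq_maxr _ _) x.
  rewrite op_hornerE nmE (nmE x) -rmorphM /= lecR in h2.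
  have h3 : bnd (hornerop (p k) X - pw X a) d.
    apply: (fcal_near Xsa (pwP a Xpos)); first exact: ltW.
    by move=> t /(spectrum_sap _ Xsa); apply: h1.
  have := h3 x; rewrite bopB => {}h3.
  rewrite -(subrKA (hornerop (p k) X x)) (le_trans (nmD _ _)) // nmB.
  apply: (@le_trans _ _ (d * (2 * (nm x + 1)))); last by rewrite divfK ?gt_eqF.
  by move: h2 h3; lra.
have ex : is_functional_calculus (fun t => t `^ a) X (pw X a).
  have /choice [p pP] : forall n : nat, exists p : {poly R},
      (forall t, approx_spectrum X t -> `|p.[t] - t `^ a| <= n.+1%:R^-1) /\
      bnd (hornerop p X - pw X a) n.+1%:R^-1.
    by move=> n; apply: (pwP a Xpos); rewrite invr_gt0 ltr0n.
  exists p; split=> e e0; have [N hN] := natSinv_small e0; exists N => // k Nk.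
    move=> t /(spectrum_sap _ Xsa) tX.
    by apply: le_trans ((pP k).1 t tX) _; apply/ltW/hN.
  move=> x; rewrite op_hornerE nmE (nmE x) -rmorphM /= lecR -bopB.
  by apply: le_trans ((pP k).2 x) _; rewrite ler_wpM2r ?nm_ge0 //; apply/ltW/hN.
rewrite /op_powR /functional_calculus; case: xgetP => [S _ /=|/(_ (pw X a))].
  exact: fcX.
by move=> /(_ ex).
Qed.

Lemma op_powR_abs X a :
  bounded_below X -> op_powR (op_abs X) a = pw (adj X * X) (a / 2).
Proof.
move=> Xbb; have Xpos := pos_gram Xbb.
rewrite /op_abs adjointE -[adj X \o X]/(bop_fun (adj X * X)) op_powRE //.
by rewrite op_powRE ?pw_pw //; [congr (pw _ _); rewrite mulrC | exact: pw_pos].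
Qed.

Lemma op_leE X Y : op_le X Y -> ole X Y.
Proof. by move=> XY x; have := XY x; rewrite lecE => /andP[]. Qed.

(** Selfadjointness makes [inner (X x) x] its own conjugate, so the imaginary parts agree, being
    zero. *)
Lemma ole_op_le X Y : selfadjoint X -> selfadjoint Y -> ole X Y -> op_le X Y.
Proof.
move=> Xsa Ysa XY x; rewrite lecE; apply/andP; split; last exact: XY.
have im0 Z : selfadjoint Z -> complex.Im (inner (Z x) x) = 0.
  move=> Zsa.
  have : inner (Z x) x = inner x (Z x).
    apply: (@rip_inner_ext _ _ Z id) => //; first by move=> c u;
      rewrite linearZ.
    by move=> u; rewrite saP.
  rewrite [in RHS]inner_hermC; case: (inner (Z x) x) => c d /= [] h.
  by have : d = - d by []; lra.
by rewrite !im0.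
Qed.

End Bridge.

(** * The chain of inequalities for powers of one operator *)

Section PowerChain.
Variables (R : realType) (H : hilbertType R).
Local Notation B := (bop H).
Implicit Types (X Y A U V : B) (a b : R).

Definition gram X : B := adj X * X.

Lemma bbX X k : bounded_below X -> bounded_below (X ^+ k).
Proof.
by move=> Xbb; elim: k => [|k IH]; [exact: bb1 | rewrite exprS; apply: bbM].
Qed.

(** [adj U] intertwines [adj U * X * U] with [X], hence also their powers. *)
Lemma pw_unitary_conj X U a : pos X -> adj U * U = 1 -> U * adj U = 1 ->
  pos (adj U * X * U) /\ pw (adj U * X * U) a = adj U * pw X a * U.
Proof.
move=> Xpos UU UU'.
have Ypos : pos (adj U * X * U).
  have -> : adj U * X * U = gram (pw X (1 / 2) * U).
    rewrite /gram adjM pw_sa // !mulrA -(mulrA (adj U) (pw _ _)) -pwD //.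
    by rewrite -splitr pw1.
  by apply/pos_gram/bbM; [exact: bb_pw | exact: bb_linv UU].
split=> //; have I : adj U * X * U * adj U = adj U * X by rewrite -mulrA UU'
  mulr1.
by rewrite -(pw_intertwine a Ypos Xpos I) -(mulrA (pw _ _)) UU mulr1.
Qed.

Section Chain.
Variables (A U : B) (m n : nat).
Let T := gram A.
Let G k := gram (A ^+ k).
Hypotheses (Abb : bounded_below A) (UU : adj U * U = 1) (UU' : U * adj U = 1).
Hypothesis AmE : A ^+ m = U * pw T (m%:R / 2).
Hypotheses (n_gt0 : (0 < n)%N) (m_gt0 : (0 < m)%N).
Hypothesis Gnm : G (n + m) = T ^+ (n + m).
Hypothesis Gn : ole (G n) (T ^+ n).

Let Tpos : pos T. Proof. exact: pos_gram. Qed.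
Let Gpos k : pos (G k). Proof. exact/pos_gram/bbX. Qed.

Let D k := adj U * G k * U.
Let Dpos k : pos (D k).
Proof. by case: (pw_unitary_conj 0 (Gpos k) UU UU'). Qed.
Let pwDk k a : pw (D k) a = adj U * pw (G k) a * U.
Proof. by case: (pw_unitary_conj a (Gpos k) UU UU'). Qed.

Let GD k : G (k + m) = pw T (m%:R / 2) * D k * pw T (m%:R / 2).
Proof.
have adjAm : adj (A ^+ m) = pw T (m%:R / 2) * adj U by rewrite AmE adjM pw_sa.
by rewrite /G /gram exprD adjM adjAm AmE /D /G /gram !mulrA.
Qed.

(** The invertible outer factors [T^(m/2)] are cancelled between [GD n] and [Gnm]. *)
Let Dn : D n = pw T n%:R.
Proof.
have E X : pw T (- (m%:R / 2)) * (pw T (m%:R / 2) * X * pw T (m%:R / 2)) *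
    pw T (- (m%:R / 2)) = X.
  by rewrite -!mulrA pwVr // mulr1 mulrA pwVl // mul1r.
rewrite -(E (D n)) -GD Gnm -pw_nat // -!pwD //; congr (pw _ _).
by rewrite natrD; field.
Qed.

Let P j := (j * m + n)%N.
Let P_gt0 j : 0 < (P j)%:R :> R.
Proof. by rewrite ltr0n /P addn_gt0 n_gt0 orbT. Qed.

Let PS j : P j.+1 = (P j + m)%N.
Proof. by rewrite /P mulSn -addnA addnC. Qed.

(** The second conjunct is carried along because, conjugated by [U], it becomes the hypothesis
    [T^n <= E^n] of the Furuta inequality in the induction step. *)
Let chain_weak j :
  ole (G (P j)) (pw (G (P j.+1)) ((P j)%:R / (P j.+1)%:R)) /\
  ole (G n) (pw (G (P j.+1)) (n%:R / (P j.+1)%:R)).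
Proof.
elim: j => [|j [IH IHn]].
  have P0 : P 0 = n by [].
  have P1 : P 1 = (n + m)%N by rewrite PS P0.
  (* At [j = 0] both conjuncts reduce to [Gn], since [G (n + m)] is a power of [T]. *)
  have -> : pw (G (P 1)) (n%:R / (P 1)%:R) = T ^+ n.
    rewrite P1 Gnm -(pw_nat (n + m) Tpos) pw_pw // -(pw_nat n Tpos).
    by congr (pw _ _); rewrite mulrC divfK // gt_eqF // -P1.
  by rewrite P0.
set q := P j.+1 in IH IHn *; set p := P j in IH *.
have q0 : 0 < q%:R :> R := P_gt0 _.
have qpm : q%:R = p%:R + m%:R :> R by rewrite /q PS natrD.
have m0 : 0 < m%:R :> R by rewrite ltr0n.
have Eq a : pw (pw (D q) q%:R^-1) a = pw (D q) (a / q%:R).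
  by rewrite pw_pw // mulrC.
set E := pw (D q) q%:R^-1 in Eq.
have Epos : pos E by apply: pw_pos.
have TE : ole (pw T n%:R) (pw E n%:R).
  by rewrite Eq -Dn pwDk; apply: ole_conj.
have DE : ole (D p) (pw E p%:R) by rewrite Eq pwDk; apply: ole_conj.
(* The Furuta inequality starts at exponent [n], where [TE] holds, and reaches [q] in [q - n] unit
   steps. *)
have qE : q = (n + (q - n))%N by rewrite subnKC // /q /P leq_addl.
have mq : m%:R <= q%:R :> R by rewrite qpm lerDr ler0n.
have Fq : furuta_le E T m%:R q%:R.
  by rewrite qE; apply: furuta_le_nat.
have key := furuta_sandwich Epos Tpos m0 mq Fq.
have qm : q%:R - m%:R = p%:R :> R by rewrite qpm addrK.
have Gq1 : sandwich T m%:R E q%:R = G (P j.+2).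
  by rewrite PS -/q GD /sandwich Eq divff ?gt_eqF // pw1.
have PSR : (P j.+2)%:R = q%:R + m%:R :> R by rewrite PS natrD.
have step : ole (G q) (pw (G (P j.+2)) (q%:R / (P j.+2)%:R)).
  rewrite PSR -Gq1; apply: ole_trans key; rewrite qm /q PS GD.
  exact: ole_pw_conj.
split=> //; apply: ole_trans IHn _.
rewrite -(pw1 (Gpos q)) in step.
apply: (ole_pw_mul (c := n%:R / q%:R) (Gpos _) (Gpos _) _ _ _ step).
- by rewrite ler_div01 ?ler0n // ler_nat /q /P leq_addl.
- by rewrite mul1r.
- by field; rewrite !gt_eqF.
Qed.

Lemma unitary_power_chain j :
  ole (pw (G (j * m + n)) (j * m + n)%:R^-1)
      (pw (G (j.+1 * m + n)) (j.+1 * m + n)%:R^-1).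
Proof.
have [h _] := chain_weak j; rewrite -/(P j) -/(P j.+1).
rewrite -(pw1 (Gpos (P j))) in h.
apply: (ole_pw_mul (c := (P j)%:R^-1) (Gpos _) (Gpos _) _ _ _ h).
- by rewrite -[_^-1]mul1r ler_div01 // ler1n -(ltr0n R).
- by rewrite mul1r.
- by field; rewrite !gt_eqF.
Qed.

End Chain.

(** [U] is the factor [A^m |A|^(-m)] of a polar decomposition: the hypothesis on [gram (A ^+ m)]
    makes it isometric and the right inverse of [A] makes it onto. *)
Lemma power_chain A V m n j :
  A * V = 1 -> bounded_below A -> (0 < n)%N -> (0 < m)%N ->
  gram (A ^+ m) = gram A ^+ m -> gram (A ^+ (n + m)) = gram A ^+ (n + m) ->
  ole (gram (A ^+ n)) (gram A ^+ n) ->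
  ole (pw (gram (A ^+ (j * m + n))) (j * m + n)%:R^-1)
      (pw (gram (A ^+ (j.+1 * m + n))) (j.+1 * m + n)%:R^-1).
Proof.
move=> AV Abb n0 m0 Gm Gnm Gn; have Tpos : pos (gram A) := pos_gram Abb.
pose h : R := m%:R / 2; pose U := A ^+ m * pw (gram A) (- h).
have AmE : A ^+ m = U * pw (gram A) h by rewrite /U -mulrA pwVl // mulr1.
have UU : adj U * U = 1.
  rewrite /U adjM pw_sa // mulrA -(mulrA _ (adj _)) -[adj _ * _]/(gram _) Gm.
  rewrite -pw_nat // -!pwD // -(pw0 Tpos); congr (pw _ _); rewrite /h; lra.
have AVk k : A ^+ k * V ^+ k = 1.
  elim: k => [|k IH]; first by rewrite !expr0 mulr1.
  by rewrite exprSr exprS mulrA -(mulrA _ A) AV mulr1.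
have UU' : U * adj U = 1.
  have UW : U * (pw (gram A) h * V ^+ m) = 1 by rewrite mulrA -AmE AVk.
  (* A left inverse and a right inverse of [U] coincide. *)
  suff -> : adj U = pw (gram A) h * V ^+ m by [].
  by rewrite -[LHS]mulr1 -UW mulrA UU mul1r.
exact: (@unitary_power_chain A U).
Qed.

End PowerChain.

Theorem theorem5p8 (R : realType) (H : hilbertType R) (m n : nat)
    (A : H -> H) :
  (0 < n)%N -> (0 < m)%N -> (n <= m)%N ->
  bounded_operator A -> op_invertible A ->
  (forall s : nat, s \in [:: m; (n + m)%N] ->
     iter s (adjoint A) \o iter s A = iter s (adjoint A \o A)) ->
  op_le (iter n (adjoint A) \o iter n A) (iter n (adjoint A \o A)) ->
  forall r : nat, (0 < r)%N ->
  forall j : nat, (j < r)%N ->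
    op_le (op_powR (op_abs (iter (j * m + n)%N A)) (2 / (j * m + n)%:R))
          (op_powR (op_abs (iter (j.+1 * m + n)%N A)) (2 / (j.+1 * m + n)%:R)).
Proof.
move=> n0 m0 nm Ab; have [X ->] : exists X : bop H, A = X by exists (Bop Ab).
move=> Xinv hs hn r _ j _.
have Xbb := op_invertible_bb Xinv.
have [V _ XV] : exists2 V, V * X = 1 & X * V = 1 by apply/op_invertible_bop.
have gramE s : iter s (adjoint X) \o iter s X = gram (X ^+ s).
  by rewrite adjointE !bop_iter /gram adjX.
have powE s : iter s (adjoint X \o X) = gram X ^+ s.
  by rewrite adjointE -[adj X \o X]/(bop_fun (adj X * X)) bop_iter.
have hG s : s \in [:: m; (n + m)%N] -> gram (X ^+ s) = gram X ^+ s.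
  by move=> /hs; rewrite gramE powE => h; apply: bop_ext => x; rewrite h.
rewrite gramE powE in hn.
(* The square root in [op_abs] halves the exponent [2 / k], which leaves the power [1 / k] of the
   Gram operator. *)
have powabsE k :
    op_powR (op_abs (iter k X)) (2 / k%:R) = pw (gram (X ^+ k)) k%:R^-1.
  rewrite bop_iter op_powR_abs; last exact: bbX.
  by rewrite mulrAC divff ?mul1r ?pnatr_eq0.
have Gpos k : pos (gram (X ^+ k)) by apply/pos_gram/bbX.
rewrite !powabsE; apply: ole_op_le; [exact: pw_sa | exact: pw_sa |].
apply: power_chain XV Xbb n0 m0 _ _ _.
- by apply: hG; rewrite inE eqxx.
- by apply: hG; rewrite !inE eqxx orbT.
- exact: op_leE.
Qed.
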